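(* Let $B$ be a $C^*$-algebra and let $J$ be a closed two-sided ideal in $B$. Let $a,b\in B$ be such that $a$ is a partial isometry and $b+J$ is a partial isometry in $B/J$. Suppose that one of the following cases holds: (i) $a^*b\in J$ and $a^*a-b^*b\in J$; (ii) $a^*b\in J$, $ab^*\in J$, and $a^*a+J\sim b^*b+J$ (Murray–von Neumann equivalence) in $B/J$. Let $r\in B$ be such that $r^*r-a^*a\in J$ and $rr^*-b^*b\in J$, where in case (i) we let $r=a^*a$. Let $\Lambda$ be a quasi-central approximate unit for $J$, and for $h\in\Lambda$ let $k=k(h)=(1-h^2)^{1/2}$. For $h\in\Lambda$ define $w=w(h)\in B$ by $$w=\begin{cases} ha+kb, & \text{in case (i)},\\ h^2a+k^2b+hk(ar^*+br), & \text{in case (ii)}.\end{cases}$$ Then $ww^*w\approx w$. Moreover $$w^*w\approx\begin{cases} a^*a, & \text{in case (i)},\\ h^2a^*a+k^2b^*b+hk(r+r^* ), & \text{in case (ii)},\end{cases}$$ and, in both cases, $$ww^*\approx h^2aa^*+k^2bb^*+hk(bra^*+ar^*b^* ).$$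
   Context: A quasi-central approximate unit $\Lambda$ for an ideal $J$ of $B$ is an upward directed family of positive contractions in $J$ forming an approximate unit for $J$ and satisfying $\lim_{h\in\Lambda}\|hx-xh\|=0$ for all $x\in B$. The element $k(h)$ lies in the unitization of $B$ (if $B$ is not unital). If $x=x(h)$ and $y=y(h)$ are elements of $B$ depending on $h\in\Lambda$, then $x\approx y$ means that $x(h)-y(h)\in J$ for all $h\in\Lambda$ and $\lim_h\|x(h)-y(h)\|=0$. *)

(* Defs.v *)
From HB Require Import structures.
From mathcomp Require Import all_boot all_order all_algebra.
From mathcomp Require Import complex.
From mathcomp Require Import all_classical all_reals all_analysis.

Set Implicit Arguments.
Unset Strict Implicit.
Unset Printing Implicit Defensive.

Import Order.TTheory GRing.Theory Num.Theory.
Import numFieldNormedType.Exports.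

Local Open Scope classical_set_scope.
Local Open Scope ring_scope.

(* MathComp's ring structures are all unital, so the multiplication of a
   (possibly non-unital) *-algebra is part of the structure below. *)
HB.mixin Record Lmodule_isStarAlgebra (C : numClosedFieldType) A
    of GRing.Lmodule C A := {
  amul : A -> A -> A ;
  astar : A -> A ;
  amulA : associative amul ;
  amulDl : left_distributive amul +%R ;
  amulDr : right_distributive amul +%R ;
  amulZl : forall (c : C) (x y : A), amul (c *: x) y = c *: amul x y ;
  amulZr : forall (c : C) (x y : A), amul x (c *: y) = c *: amul x y ;
  astarK : involutive astar ;
  astarD : {morph astar : x y / x + y} ;
  astarZ : forall (c : C) (x : A), astar (c *: x) = c^* *: astar x ;
  astarM : forall x y : A, astar (amul x y) = amul (astar y) (astar x)
}.

#[short(type="starAlgType")]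
HB.structure Definition StarAlgebra (C : numClosedFieldType) :=
  {A of GRing.Lmodule C A & Lmodule_isStarAlgebra C A}.

Notation "x ** y" := (amul x y) (at level 40, left associativity) : ring_scope.
Notation "x ^#" := (astar x) (at level 3, left associativity, format "x ^#") :
  ring_scope.

(* The norm of a normed module over R[i] takes its values in R[i]. *)
HB.mixin Record isCStarAlgebra (R : realType) A
    of CompleteNormedModule R[i] A & StarAlgebra R[i] A := {
  ler_normaM : forall x y : A, `|amul x y| <= `|x| * `|y| ;
  cstar_identity : forall x : A, `|amul (astar x) x| = `|x| ^+ 2
}.

#[short(type="cstarAlgType")]
HB.structure Definition CStarAlgebra (R : realType) :=
  {A of CompleteNormedModule R[i] A & StarAlgebra R[i] A & isCStarAlgebra R A}.

Section AlgebraTheory.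
Context {C : numClosedFieldType} {A : starAlgType C}.
Implicit Types x y : A.

Lemma amul0l x : amul 0 x = 0.
Proof. by rewrite -[in LHS](scale0r (0 : A)) amulZl scale0r. Qed.

Lemma amul0r x : amul x 0 = 0.
Proof. by rewrite -[in LHS](scale0r (0 : A)) amulZr scale0r. Qed.

End AlgebraTheory.

(* The unitization adjoins a unit to A whether or not A already has one.  If A
   has a unit e, then (y, c) |-> (y + c *: e, c) identifies it with the product
   of *-algebras A x C and the action [uact] below with the action of the first
   component.  The positive square root of 1 - h^2 (h in A) thus acts on A as
   the positive square root of e - h^2 computed in A, and an element of A is
   positive in A if and only if it is positive in the unitization. *)
Definition unitization (C : numClosedFieldType) (A : starAlgType C) : Type :=
  (A * C^o)%type.

Section Unitization.
Context {C : numClosedFieldType} {A : starAlgType C}.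

HB.instance Definition _ := GRing.Lmodule.on (unitization A).

Definition umul (u v : unitization A) : unitization A :=
  (amul u.1 v.1 + u.2 *: v.1 + v.2 *: u.1, u.2 * v.2).

Definition ustar (u : unitization A) : unitization A := (astar u.1, u.2^*).

Fact umulA : associative umul.
Proof.
move=> [x a] [y b] [z c]; rewrite /umul /=; congr pair; last by rewrite mulrA.
rewrite !amulDl !amulDr !scalerDr !amulZl !amulZr !amulA !scalerA.
rewrite (mulrC c a) (mulrC c b).
rewrite -!addrA; congr (_ + _); rewrite [RHS]addrCA; congr (_ + _).
by rewrite addrCA; congr (_ + _); rewrite addrCA.
Qed.

Fact umulDl : left_distributive umul +%R.
Proof.
move=> [x a] [y b] [z c]; rewrite /umul /=; congr pair; last by rewrite mulrDl.
by rewrite amulDl scalerDl scalerDr [RHS]addrACA; congr (_ + _); rewrite addrACA.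
Qed.

Fact umulDr : right_distributive umul +%R.
Proof.
move=> [x a] [y b] [z c]; rewrite /umul /=; congr pair; last by rewrite mulrDr.
by rewrite amulDr scalerDl scalerDr [RHS]addrACA; congr (_ + _); rewrite addrACA.
Qed.

Fact umulZl (c : C) (u v : unitization A) : umul (c *: u) v = c *: umul u v.
Proof.
case: u v => [x a] [y b]; rewrite /umul /=; congr pair; last by rewrite -mulrA.
by rewrite amulZl !scalerDr !scalerA (mulrC b c).
Qed.

Fact umulZr (c : C) (u v : unitization A) : umul u (c *: v) = c *: umul u v.
Proof.
case: u v => [x a] [y b]; rewrite /umul /=; congr pair; last by rewrite mulrCA.
by rewrite amulZr !scalerDr !scalerA (mulrC a c).
Qed.

Fact ustarK : involutive ustar.
Proof. by move=> [x a]; rewrite /ustar /= astarK conjCK. Qed.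

Fact ustarD : {morph ustar : u v / u + v}.
Proof. by move=> [x a] [y b]; rewrite /ustar /= astarD rmorphD. Qed.

Fact ustarZ (c : C) (u : unitization A) : ustar (c *: u) = c^* *: ustar u.
Proof. by case: u => [x a]; rewrite /ustar /= astarZ rmorphM. Qed.

Fact ustarM (u v : unitization A) : ustar (umul u v) = umul (ustar v) (ustar u).
Proof.
case: u v => [x a] [y b]; rewrite /ustar /umul /=.
congr pair; last by rewrite rmorphM mulrC.
by rewrite !astarD astarM !astarZ addrAC.
Qed.

HB.instance Definition _ := Lmodule_isStarAlgebra.Build C (unitization A)
  umulA umulDl umulDr umulZl umulZr ustarK ustarD ustarZ ustarM.

Definition uone : unitization A := (0, 1).

Definition uemb (x : A) : unitization A := (x, 0).

(* A is an ideal of its unitization; [uact u x] is the product u x in A. *)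
Definition uact (u : unitization A) (x : A) : A := amul u.1 x + u.2 *: x.

Fact umul1l (u : unitization A) : amul uone u = u.
Proof.
case: u => x a; rewrite [LHS]/(umul _ _) /umul /=.
by rewrite amul0l add0r scale1r scaler0 addr0 mul1r.
Qed.

Fact umul1r (u : unitization A) : amul u uone = u.
Proof.
case: u => x a; rewrite [LHS]/(umul _ _) /umul /=.
by rewrite amul0r add0r scaler0 add0r scale1r mulr1.
Qed.

Fact uemb_act (u : unitization A) (x : A) : uemb (uact u x) = amul u (uemb x).
Proof.
by case: u => y a; rewrite [RHS]/(umul _ _) /umul /uemb /uact /= scale0r addr0 mulr0.
Qed.

Definition spectrum (u : unitization A) : set C :=
  [set z | ~ exists v : unitization A,
     amul v (z *: uone - u) = uone /\ amul (z *: uone - u) v = uone].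

(* In a numClosedFieldType, 0 <= z means that z is a nonnegative real. *)
Definition upositive (u : unitization A) : Prop :=
  astar u = u /\ spectrum u `<=` [set z | 0 <= z].

Definition apositive (x : A) : Prop := upositive (uemb x).

Definition ale (x y : A) : Prop := apositive (y - x).

Definition is_psqrt (u v : unitization A) : Prop :=
  upositive v /\ amul v v = u.

End Unitization.

(* The following two notions are used both in an algebra and in a quotient
   algebra, so they are relative to a product and an involution on a set D. *)
Definition partial_isometry (T : Type) (mul : T -> T -> T) (star : T -> T)
  (v : T) : Prop := mul (mul v (star v)) v = v.

Definition mvn_equiv (T : Type) (D : set T) (mul : T -> T -> T)
  (star : T -> T) (p q : T) : Prop :=
  exists v, [/\ D v, mul (star v) v = p & mul v (star v) = q].

Section Ideal.
Context {R : realType} {B : cstarAlgType R}.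
Implicit Types (J Lam P Q : set B) (x y : B) (f g : B -> B).

Definition closed_ideal J : Prop :=
  [/\ J 0, forall x y, J x -> J y -> J (x + y),
      forall (c : R[i]) x, J x -> J (c *: x),
      forall x y, J y -> J (x ** y) /\ J (y ** x) & closed J].

(* The elements of B/J are the sets x + J.  Modulo the closed ideal J, which is
   automatically self-adjoint, cmul J (x + J) (y + J) is x ** y + J and
   cstar (x + J) is x^# + J. *)
Definition coset J x : set B := [set x + j | j in J].

Definition cosets J : set (set B) := range (coset J).

Definition cmul J P Q : set B :=
  [set z | exists x y j, [/\ P x, Q y, J j & z = x ** y + j]].

Definition cstar P : set B := [set x^# | x in P].

(* Lam is a net indexed by itself, ordered by the order of B. *)
Definition tails Lam : set_system B :=
  filter_from Lam (fun h0 => [set h | Lam h /\ ale h0 h]).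

Definition upward_directed Lam : Prop :=
  Lam !=set0 /\
  forall h1 h2, Lam h1 -> Lam h2 ->
    exists h3, [/\ Lam h3, ale h1 h3 & ale h2 h3].

Definition approximate_unit J Lam : Prop :=
  [/\ upward_directed Lam,
      forall h, Lam h -> [/\ J h, apositive h & `|h| <= 1] &
      forall x, J x -> h ** x @[h --> tails Lam] --> x /\
                       x ** h @[h --> tails Lam] --> x].

Definition quasi_central_approximate_unit J Lam : Prop :=
  approximate_unit J Lam /\
  forall x, h ** x - x ** h @[h --> tails Lam] --> (0 : B).

Definition approx_mod J Lam f g : Prop :=
  (forall h, Lam h -> J (f h - g h)) /\
  f h - g h @[h --> tails Lam] --> (0 : B).

End Ideal.

(* Main.v *)
(** With k = (1 - h^2)^(1/2), p = a^* a and c = b r, everything is reduced to the net u = h a + k c.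
    Modulo nets that take values in J and tend to 0, both h and k commute with constants and k
    kills J, so that u^* u = p and u u^* is the required final projection. In case (i), w = u. In
    case (ii), w = u t with t = h + r^* k, and p t t^* p = p because p r lies in J.

    Positivity and the square root k are only known through the spectrum. A selfadjoint element c of
    norm at most 1 for which 1 - c^2 is invertible has norm less than 1: square roots given by an
    explicit iteration produce e commuting with c such that c^2 + e^2 is a scalar smaller than 1.
    So a spectral bound is a norm bound, which makes sums of positive elements positive, hence the
    tails of the approximate unit a filter, and makes 1 - k a contraction, hence the uniform limit
    of polynomials in h^2. *)
Require Import Defs.
From HB Require Import structures.
From mathcomp Require Import all_boot all_order all_algebra.
From mathcomp Require Import complex.
From mathcomp Require Import all_classical all_reals all_analysis.
From mathcomp Require Import ring lra.
From Stdlib Require Setoid.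
Set Implicit Arguments.
Unset Strict Implicit.
Unset Printing Implicit Defensive.
Import Order.TTheory GRing.Theory Num.Theory.
Import numFieldNormedType.Exports.
Local Open Scope classical_set_scope.
Local Open Scope ring_scope.

(** * Real-valued norms *)

Section RealNorm.
Context {R : realType}.

(** The norm is a nonnegative real inside [R[i]]; its real part lives in the ordered field [R],
    where inequalities are settled by linear and polynomial arithmetic. *)
Definition nrm (V : normedModType R[i]) (x : V) : R := complex.Re `|x|.

Context {V : normedModType R[i]}.
Implicit Types x y : V.

Lemma nrmE x : `|x| = (nrm x)%:C%C.
Proof. by rewrite /nrm RRe_real// ger0_real. Qed.

Lemma nrm_ge0 x : 0 <= nrm x.
Proof. by rewrite -ler0c -nrmE. Qed.

Lemma nrm_leP x (M : R) : (nrm x <= M) = (`|x| <= M%:C%C).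
Proof. by rewrite nrmE lecR. Qed.

Lemma nrmD x y : nrm (x + y) <= nrm x + nrm y.
Proof. by rewrite nrm_leP rmorphD/= -!nrmE ler_normD. Qed.

Lemma nrmN x : nrm (- x) = nrm x.
Proof. by rewrite /nrm normrN. Qed.

Lemma nrmB x y : nrm (x - y) <= nrm x + nrm y.
Proof. by rewrite -(nrmN y) nrmD. Qed.

Lemma nrmZ (c : R[i]) x : nrm (c *: x) = nrm (c : R[i]^o) * nrm x.
Proof. by rewrite /nrm normrZ !nrmE /= !mul0r subr0. Qed.

Lemma nrm0 : nrm (0 : V) = 0.
Proof. by rewrite /nrm normr0. Qed.

Lemma nrm_eq0 x : nrm x = 0 -> x = 0.
Proof. by move=> h; apply/normr0_eq0; rewrite nrmE h. Qed.

Lemma cvg_nrmP (T : Type) (F : set_system T) {FF : Filter F} (f : T -> V) (l : V) :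
  (f x @[x --> F] --> l) <-> forall e : R, 0 < e -> \forall x \near F, nrm (l - f x) < e.
Proof.
split=> [/cvgrPdist_lt h e e0|h].
  have := h e%:C%C; rewrite ltcR => /(_ e0); apply: filterS => x.
  by rewrite nrmE ltcR.
apply/cvgrPdist_lt => e e0.
have eE : e = (complex.Re e)%:C%C by rewrite RRe_real// gtr0_real.
have := h (complex.Re e); rewrite -ltcR -eE => /(_ e0); apply: filterS => x.
by move=> le; rewrite nrmE eE ltcR.
Qed.

End RealNorm.

Section Scalars.
Context {R : realType}.
Implicit Types (c d : R[i]^o) (t : R).

Lemma nrmM c d : nrm (c * d : R[i]^o) = nrm c * nrm d.
Proof. exact: nrmZ. Qed.

Lemma nrmR t : nrm (t%:C%C : R[i]^o) = `|t|.
Proof. by rewrite /nrm normc_def /= expr0n /= addr0 sqrtr_sqr. Qed.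

Lemma nrm_sqr c : nrm c ^+ 2 = complex.Re c ^+ 2 + complex.Im c ^+ 2.
Proof.
by rewrite /nrm normc_def/= sqr_sqrtr// addr_ge0// sqr_ge0.
Qed.

Lemma nrm_conj c : nrm (c^* : R[i]^o) = nrm c.
Proof. by rewrite /nrm norm_conjC. Qed.

Lemma Re_le_nrm c : `|complex.Re c| <= nrm c.
Proof. by rewrite -lecR -nrmE; exact: normc_ge_Re. Qed.

Lemma Im_le_nrm c : `|complex.Im c| <= nrm c.
Proof.
rewrite -(ler_pXn2r (n := 2))// ?nnegrE ?nrm_ge0//.
by rewrite nrm_sqr real_normK ?num_real// lerDr sqr_ge0.
Qed.

Lemma nrm_le_ReIm c : nrm c <= `|complex.Re c| + `|complex.Im c|.
Proof.
rewrite -(ler_pXn2r (n := 2))// ?nnegrE ?nrm_ge0 ?addr_ge0//.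
rewrite nrm_sqr sqrrD !real_normK ?num_real// lerD2r lerDl.
by rewrite mulrn_wge0// mulr_ge0.
Qed.

End Scalars.

Section CStar.
Context {R : realType} {B : cstarAlgType R}.
Implicit Types x y : B.

Lemma nrm_amul x y : nrm (x ** y) <= nrm x * nrm y.
Proof. by rewrite nrm_leP rmorphM/= -!nrmE ler_normaM. Qed.

Lemma nrm_cstar x : nrm (x^# ** x) = nrm x ^+ 2.
Proof. by apply/complexI; rewrite rmorphXn/= -!nrmE cstar_identity. Qed.

(** The C*-identity and submultiplicativity give |y|^2 <= |y^#| |y|; cancel |y| and exchange y with
    y^#. *)
Lemma nrm_star x : nrm x^# = nrm x.
Proof.
suff H y : nrm y <= nrm y^# by apply/eqP; rewrite eq_le H -{2}(astarK x) H.
have [->|y0] := eqVneq (nrm y) 0; first exact: nrm_ge0.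
have yp : 0 < nrm y by rewrite lt_def y0 nrm_ge0.
by rewrite -(ler_pM2r yp) -expr2 -nrm_cstar nrm_amul.
Qed.

Lemma amulNl x y : (- x) ** y = - (x ** y).
Proof. by rewrite -scaleN1r amulZl scaleN1r. Qed.

Lemma amulNr x y : x ** (- y) = - (x ** y).
Proof. by rewrite -scaleN1r amulZr scaleN1r. Qed.

Lemma amulBl x y z : (x - y) ** z = x ** z - y ** z.
Proof. by rewrite amulDl amulNl. Qed.

Lemma amulBr x y z : x ** (y - z) = x ** y - x ** z.
Proof. by rewrite amulDr amulNr. Qed.

Lemma astar0 : (0 : B)^# = 0.
Proof. by rewrite -[in LHS](scale0r (0 : B)) astarZ rmorph0 scale0r. Qed.

Lemma astarN x : (- x)^# = - x^#.
Proof. by rewrite -scaleN1r astarZ rmorphN1 scaleN1r. Qed.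

Lemma astarB x y : (x - y)^# = x^# - y^#.
Proof. by rewrite astarD astarN. Qed.

End CStar.

Lemma uone_neq0 (C : numClosedFieldType) (A : starAlgType C) :
  uone != 0 :> unitization A.
Proof. by apply/eqP => -[] /eqP; rewrite oner_eq0. Qed.

(** The unitization becomes a unital algebra, so that the generic ring lemmas on powers, sums and
    commutation apply to it, although [B] may have no unit. *)
HB.instance Definition _ (C : numClosedFieldType) (A : starAlgType C) :=
  GRing.Zmodule_isNzRing.Build (unitization A)
    umulA umul1l umul1r umulDl umulDr (@uone_neq0 C A).

HB.instance Definition _ (C : numClosedFieldType) (A : starAlgType C) :=
  GRing.Lmodule_isLalgebra.Build C (unitization A)
    (fun c u v => esym (umulZl c u v)).

HB.instance Definition _ (C : numClosedFieldType) (A : starAlgType C) :=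
  GRing.Lalgebra_isAlgebra.Build C (unitization A)
    (fun c u v => esym (umulZr c u v)).

(** * The unitization *)

Section UnitizationTheory.
Context {R : realType} {B : cstarAlgType R}.
Local Notation U := (unitization B).
Implicit Types (u v : U) (x y : B) (M N : R).

Lemma uembM x y : uemb (x ** y) = uemb x * uemb y :> U.
Proof. by rewrite -[RHS](uemb_act (uemb x)) /uact /= scale0r addr0. Qed.

Lemma uembD x y : uemb (x + y) = uemb x + uemb y :> U.
Proof. by congr pair; rewrite addr0. Qed.

Lemma uembN x : uemb (- x) = - uemb x :> U.
Proof. by congr pair; rewrite oppr0. Qed.

Lemma uembB x y : uemb (x - y) = uemb x - uemb y :> U.
Proof. by rewrite uembD uembN. Qed.

Lemma uemb_star x : uemb x^# = (uemb x)^# :> U.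
Proof. by congr pair; rewrite rmorph0. Qed.

Lemma uemb_actE u x : uemb (uact u x) = u * uemb x.
Proof. exact: uemb_act. Qed.

Lemma uemb_inj : injective (uemb : B -> U).
Proof. by move=> x y []. Qed.

Lemma uactM u v x : uact (u * v) x = uact u (uact v x).
Proof. by apply: uemb_inj; rewrite !uemb_actE mulrA. Qed.

Lemma uactDl u v x : uact (u + v) x = uact u x + uact v x.
Proof. by apply: uemb_inj; rewrite [RHS]uembD !uemb_actE mulrDl. Qed.

Lemma uactNl u x : uact (- u) x = - uact u x.
Proof. by apply: uemb_inj; rewrite [RHS]uembN !uemb_actE mulNr. Qed.

Lemma uactBl u v x : uact (u - v) x = uact u x - uact v x.
Proof. by rewrite uactDl uactNl. Qed.

Lemma uact1 x : uact 1 x = x.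
Proof. by rewrite /uact /= amul0l add0r scale1r. Qed.

Lemma uactZ (c : R[i]) u x : uact (c *: u) x = c *: uact u x.
Proof. by rewrite /uact /= amulZl scalerDr scalerA. Qed.

Lemma uact_emb x y : uact (uemb x) y = x ** y.
Proof. by rewrite /uact /= scale0r addr0. Qed.

Lemma ustar_mul u v : (u * v)^# = v^# * u^#.
Proof. exact: astarM. Qed.

Lemma ustar1 : (1 : U)^# = 1.
Proof. by congr pair; rewrite ?astar0 ?rmorph1. Qed.

Lemma ustarN u : (- u)^# = - u^#.
Proof. by rewrite -scaleN1r astarZ rmorphN1 scaleN1r. Qed.

Lemma ustarB u v : (u - v)^# = u^# - v^#.
Proof. by rewrite astarD ustarN. Qed.

(** For the [B]-valued inner product x^# y, left multiplication by u has the adjoint u^#. *)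
Lemma uact_adj u x y : (uact u x)^# ** y = x^# ** uact u^# y.
Proof.
by apply: uemb_inj; rewrite !uembM uemb_star !uemb_actE ustar_mul uemb_star mulrA.
Qed.

(* A bound for the maximum of the norm of [u] as a left multiplier of [B] and of the modulus of its
   scalar part: whether or not [B] is unital, this maximum is the C*-norm of the unitization. *)
Definition ubound u M := nrm (u.2 : R[i]^o) <= M /\
  forall x, nrm (uact u x) <= M * nrm x.

Lemma ubound_ge0 u M : ubound u M -> 0 <= M.
Proof. by case=> + _; apply/le_trans/nrm_ge0. Qed.

Lemma ubound_le M N u : M <= N -> ubound u M -> ubound u N.
Proof.
move=> MN [h1 h2]; split; first exact: le_trans MN.
by move=> x; apply: le_trans (h2 x) _; rewrite ler_wpM2r// nrm_ge0.
Qed.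

Lemma ubound_emb x : ubound (uemb x) (nrm x).
Proof.
split=> [|y]; first by rewrite nrm0 nrm_ge0.
by rewrite uact_emb nrm_amul.
Qed.

Lemma ubound1 : ubound 1 1.
Proof.
by split=> [|y]; rewrite ?uact1 ?mul1r//= (nrmR 1) normr1.
Qed.

Lemma ubound0 : ubound 0 0.
Proof.
by split=> [|y]; rewrite ?nrm0// mul0r (uact_emb 0) amul0l nrm0.
Qed.

Lemma uboundD u v M N : ubound u M -> ubound v N -> ubound (u + v) (M + N).
Proof.
move=> [a b] [c d]; split=> [|y]; first by apply: le_trans (nrmD _ _) (lerD a c).
by rewrite uactDl mulrDl; apply: le_trans (nrmD _ _) (lerD _ _).
Qed.

Lemma uboundN u M : ubound u M -> ubound (- u) M.
Proof.
move=> [a b]; split=> [|y]; first by rewrite nrmN.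
by rewrite uactNl nrmN.
Qed.

Lemma uboundB u v M N : ubound u M -> ubound v N -> ubound (u - v) (M + N).
Proof. by move=> uM /uboundN; exact: uboundD. Qed.

Lemma uboundM u v M N : ubound u M -> ubound v N -> ubound (u * v) (M * N).
Proof.
move=> uM vN; have M0 := ubound_ge0 uM; have N0 := ubound_ge0 vN.
case: uM vN => a b [c d]; split=> [|y]; first by rewrite nrmM ler_pM// nrm_ge0.
by rewrite uactM (le_trans (b _))// -mulrA ler_wpM2l.
Qed.

Lemma uboundZ (c : R[i]) u M : ubound u M -> ubound (c *: u) (nrm (c : R[i]^o) * M).
Proof.
move=> [a b]; split=> [|y]; first by rewrite nrmZ ler_wpM2l// nrm_ge0.
by rewrite uactZ nrmZ -mulrA ler_wpM2l// nrm_ge0.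
Qed.

Lemma ubound_scalar (c : R[i]) : ubound (c *: 1) (nrm (c : R[i]^o)).
Proof. by rewrite -[nrm _]mulr1; exact: uboundZ ubound1. Qed.

Lemma uboundX u M n : ubound u M -> ubound (u ^+ n) (M ^+ n).
Proof.
move=> uM; elim: n => [|n IH]; first by rewrite !expr0; exact: ubound1.
by rewrite !exprS; exact: uboundM.
Qed.

(** The C*-identity passes from [B] to its multipliers: |u y|^2 = |y^# (u^# u y)| <= M^2 |y|^2. The
    scalar part is treated separately. *)
Lemma ubound_cstar u M : 0 <= M -> ubound (u^# * u) (M ^+ 2) -> ubound u M.
Proof.
move=> M0 [a b]; split=> [|y].
  rewrite -(ler_pXn2r (n := 2)) ?nnegrE ?nrm_ge0//.
  by move: a; rewrite (nrmM (u.2)^* u.2) nrm_conj.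
rewrite -(ler_pXn2r (n := 2)) ?nnegrE ?nrm_ge0// ?mulr_ge0 ?nrm_ge0//.
rewrite -nrm_cstar uact_adj -uactM (le_trans (nrm_amul _ _))// nrm_star.
by rewrite exprMn mulrC [nrm y ^+ 2]expr2 mulrA ler_wpM2r ?nrm_ge0.
Qed.

(** Here |u^# y|^2 = |y^# (u u^# y)| <= |y| M |u^# y|, and |u^# y| cancels. *)
Lemma ubound_star u M : ubound u M -> ubound u^# M.
Proof.
move=> uM; have M0 := ubound_ge0 uM; case: uM => a b; split=> [|y].
  by rewrite nrm_conj.
have [->|y0] := eqVneq (nrm (uact u^# y)) 0; first by rewrite mulr_ge0 ?nrm_ge0.
have yp : 0 < nrm (uact u^# y) by rewrite lt_def y0 nrm_ge0.
rewrite -(ler_pM2r yp) -expr2 -nrm_cstar uact_adj astarK.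
rewrite (le_trans (nrm_amul _ _))// nrm_star mulrC -mulrA (mulrC (nrm y)) mulrA.
by rewrite ler_wpM2r ?nrm_ge0.
Qed.

(** Testing the multiplier x on x^# gives |x|^2 <= M |x|. With [ubound_emb], the embedding of [B] is
    isometric. *)
Lemma ubound_embW x M : ubound (uemb x) M -> nrm x <= M.
Proof.
move=> xM; have [_ h] := xM; have M0 := ubound_ge0 xM.
have [->//|x0] := eqVneq (nrm x) 0.
have xp : 0 < nrm x by rewrite lt_def x0 nrm_ge0.
have := h x^#; rewrite uact_emb -{1}(astarK x) nrm_cstar nrm_star expr2.
by rewrite ler_pM2r.
Qed.

(** The first component is u minus its scalar part, and M bounds both. Convergence in the
    unitization is thereby convergence of both components. *)
Lemma ubound_fst u M : ubound u M -> nrm u.1 <= 2 * M.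
Proof.
move=> uM; apply: ubound_embW.
have -> : uemb u.1 = u - u.2 *: 1.
  by case: u uM => x c _; congr pair; rewrite /= ?scaler0 ?subr0 // [_ *: _](mulr1 c) subrr.
rewrite mulr_natl mulr2n; apply: uboundB => //.
by apply: ubound_le (ubound_scalar _); case: uM.
Qed.

Lemma ubound_pair u : ubound u (nrm u.1 + nrm (u.2 : R[i]^o)).
Proof.
have {1}-> : u = uemb u.1 + u.2 *: 1.
  by case: u => x c; congr pair; rewrite /= ?scaler0 ?addr0 // [_ *: _](mulr1 c) add0r.
exact: uboundD (ubound_emb _) (ubound_scalar _).
Qed.

Lemma ubound_eq0 u : (forall e : R, 0 < e -> ubound u e) -> u = 0.
Proof.
move=> h; have h1 : nrm (u.2 : R[i]^o) = 0.
  by apply/le_anti; rewrite nrm_ge0 andbT; apply/ler_addgt0Pl => e /h[]; rewrite addr0.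
have h2 : nrm u.1 = 0.
  apply/le_anti; rewrite nrm_ge0 andbT; apply/ler_addgt0Pl => e e0.
  have /h/ubound_fst : 0 < e / 2 by rewrite divr_gt0.
  by rewrite addr0 mulrC divfK.
by case: u h1 h2 {h} => x c /= /nrm_eq0-> /nrm_eq0->.
Qed.

End UnitizationTheory.

(** * Completeness of the unitization and Neumann series *)

Lemma complete_seq_lim (K : numFieldType) (V : completeNormedModType K)
  (x : nat -> V) (e : nat -> K) :
  (forall n m, (n <= m)%N -> `|x m - x n| <= e n) ->
  (forall d, 0 < d -> exists n, e n < d) ->
  exists l, forall n, `|l - x n| <= e n.
Proof.
move=> xe e0.
have cx : cvg (x @ \oo).
  apply/cauchy_cvgP/cauchy_ballP => d d0.
  have d20 : 0 < d / 2 by rewrite divr_gt0.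
  have [n end2] := e0 (d / 2) d20.
  (* This closed ball contains a whole tail of the sequence, and any two of its points are closer
     than d. *)
  pose A := [set y | `|y - x n| <= e n].
  exists (A, A); first by split; exists n => // m /= nm; exact: xe.
  case=> i j /= [ni nj]; rewrite -ball_normE /= (splitr d).
  rewrite -(subrKA (x n)) (le_lt_trans (ler_normD _ _))// ltrD//.
    exact: le_lt_trans ni end2.
  by rewrite distrC; exact: le_lt_trans nj end2.
exists (lim (x @ \oo)) => n; apply/ler_addgt0Pl => d d0.
move/cvgrPdist_lt : cx => /(_ d d0) [N _ hN].
rewrite -(subrKA (x (maxn N n))) (le_trans (ler_normD _ _))// lerD//.
  by apply/ltW/hN; rewrite /= leq_maxl.
by apply: xe; rewrite leq_maxr.
Qed.

Section UnitizationComplete.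
Context {R : realType} {B : cstarAlgType R}.
Local Notation U := (unitization B).
Implicit Types (u v : U) (M N d : R).

Lemma nrm_complete (V : completeNormedModType R[i]) (x : nat -> V) (e : nat -> R) :
  (forall n m, (n <= m)%N -> nrm (x m - x n) <= e n) ->
  (forall d, 0 < d -> exists n, e n < d) ->
  exists l, forall n, nrm (l - x n) <= e n.
Proof.
move=> xe e0.
have [|d d0|l hl] := @complete_seq_lim _ V x (fun n => (e n)%:C%C).
- by move=> n m nm; rewrite -nrm_leP; exact: xe.
- have dE : d = (complex.Re d)%:C%C by rewrite RRe_real// gtr0_real.
  have := e0 (complex.Re d); rewrite -ltcR -dE => /(_ d0)[n nd].
  by exists n; rewrite dE ltcR.
- by exists l => n; rewrite nrm_leP.
Qed.

(** Real and imaginary parts converge separately, each with error [e n]; adding them costs the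
    factor 2. *)
Lemma nrm_complete_scalar (x : nat -> R[i]^o) (e : nat -> R) :
  (forall n m, (n <= m)%N -> nrm (x m - x n) <= e n) ->
  (forall d, 0 < d -> exists n, e n < d) ->
  exists l : R[i]^o, forall n, nrm (l - x n) <= 2 * e n.
Proof.
move=> xe e0.
have [||a ha] := @complete_seq_lim _ R^o (fun n => complex.Re (x n)) e.
- by move=> n m nm; rewrite -raddfB; exact: le_trans (Re_le_nrm _) (xe _ _ nm).
- exact: e0.
have [||b hb] := @complete_seq_lim _ R^o (fun n => complex.Im (x n)) e.
- by move=> n m nm; rewrite -raddfB; exact: le_trans (Im_le_nrm _) (xe _ _ nm).
- exact: e0.
exists (a +i* b)%C => n; apply: le_trans (nrm_le_ReIm _) _.
by rewrite !raddfB/= mulr_natl mulr2n; exact: lerD (ha n) (hb n).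
Qed.

(** The factor 4 is 2 from [ubound_fst] plus 2 from the scalar component. *)
Lemma ubound_complete (u : nat -> U) (e : nat -> R) :
  (forall n m, (n <= m)%N -> ubound (u m - u n) (e n)) ->
  (forall d, 0 < d -> exists n, e n < d) ->
  exists l, forall n, ubound (l - u n) (4 * e n).
Proof.
move=> ue e0.
have [||a ha] := @nrm_complete B (fun n => (u n).1) (fun n => 2 * e n).
- by move=> n m nm; exact: ubound_fst (ue n m nm).
- move=> d d0; have [|n nd] := e0 (d / 2); first by rewrite divr_gt0.
  by exists n; rewrite mulrC -ltr_pdivlMr.
have [||c hc] := @nrm_complete_scalar (fun n => (u n).2) e.
- by move=> n m nm; case: (ue n m nm).
- exact: e0.
exists (a, c) => n; apply: ubound_le (ubound_pair _).
rewrite [leRHS](_ : _ = 2 * e n + 2 * e n); last by ring.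
exact: lerD (ha n) (hc n).
Qed.

(** The commutator of v with l equals that with l - u n, so it is at most 2 K e n. *)
Lemma unif_cvg_comm (u : nat -> U) (e : nat -> R) l v K :
  (forall n, ubound (l - u n) (e n)) ->
  (forall d, 0 < d -> exists n, e n < d) ->
  ubound v K -> (forall n, GRing.comm v (u n)) -> GRing.comm v l.
Proof.
move=> ue e0 vK vu; apply/subr0_eq/ubound_eq0 => d d0.
have K0 := ubound_ge0 vK.
have [|n nd] := e0 (d / (2 * K + 1)); first by rewrite divr_gt0//; lra.
have -> : v * l - l * v = v * (l - u n) - (l - u n) * v.
  by rewrite mulrBr mulrBl vu opprB addrA subrK.
apply: ubound_le (uboundB (uboundM vK (ue n)) (uboundM (ue n) vK)).
move: nd; rewrite ltr_pdivlMr; last by lra.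
have := ubound_ge0 (ue n); nra.
Qed.

Lemma exp_to0 (M : R) : 0 <= M < 1 -> forall d, 0 < d -> exists n, M ^+ n < d.
Proof.
move=> /andP[M0 M1] d d0.
have : M ^+ n @[n --> \oo] --> 0 by apply: cvg_expr; rewrite ger0_norm.
move/cvgrPdist_lt => /(_ d d0) [n _ hn]; exists n.
by have := hn n (leqnn n); rewrite /= sub0r normrN ger0_norm// exprn_ge0.
Qed.

Definition uinvertible u := exists v, v * u = 1 /\ u * v = 1.

(** The geometric series converges to the inverse; its partial sums commute with 1 - u, so the
    inverse is two-sided. *)
Lemma neumann u M : ubound u M -> M < 1 -> uinvertible (1 - u).
Proof.
move=> uM M1; have M0 := ubound_ge0 uM.
pose S n := \sum_(i < n) u ^+ i.
have SE n : (1 - u) * S n = 1 - u ^+ n by rewrite -opprB mulNr -subrX1 opprB.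
have uS n : GRing.comm u (S n).
  by apply: commr_sum => i _; exact: commrX.
have SE' n : S n * (1 - u) = 1 - u ^+ n.
  by rewrite -SE; apply: commrB => //; [exact: commr1|exact/commr_sym].
have D0 : 0 < 1 - M by lra.
have Sb n m : (n <= m)%N -> ubound (S m - S n) ((M ^+ n - M ^+ m) / (1 - M)).
  move=> /subnK <-; elim: (m - n)%N => [|k IH].
    by rewrite !subrr mul0r; exact: ubound0.
  have -> : S (k.+1 + n)%N - S n = (S (k + n)%N - S n) + u ^+ (k + n).
    by rewrite /S addSn big_ord_recr /= addrAC.
  apply: ubound_le (uboundD IH (uboundX _ uM)).
  rewrite addSn exprS; set a := M ^+ n; set b := M ^+ _.
  by rewrite le_eqVlt; apply/orP; left; apply/eqP; field; lra.
have Sb' n m : (n <= m)%N -> ubound (S m - S n) (M ^+ n / (1 - M)).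
  move=> /Sb; apply: ubound_le; rewrite ler_pM2r ?invr_gt0//.
  by rewrite gerBl exprn_ge0.
have e0 d : 0 < d -> exists n, M ^+ n / (1 - M) < d.
  move=> d0; have [||n hn] := @exp_to0 M _ (d * (1 - M)).
  - by rewrite M0.
  - by rewrite mulr_gt0.
  by exists n; rewrite ltr_pdivrMr.
have [l hl] := ubound_complete Sb' e0.
have lc : GRing.comm (1 - u) l.
  apply: (unif_cvg_comm (K := 1 + M) hl) => [d d0||n].
  - by have [|n nd] := e0 (d / 4); [rewrite divr_gt0|exists n; lra].
  - exact: uboundB ubound1 uM.
  - by rewrite /GRing.comm SE SE'.
have l1 : (1 - u) * l = 1.
  apply/subr0_eq/ubound_eq0 => d d0.
  (* With c = M^n / (1 - M), the first term below is at most (1 + M) 4 c <= 8 c and the second is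
     M^n <= c, which makes 9 c. *)
  have [|n nd] := e0 (d / 9); first by rewrite divr_gt0.
  have -> : (1 - u) * l - 1 = (1 - u) * (l - S n) - u ^+ n.
    by rewrite mulrBr SE opprB addrA addrAC addrK.
  apply: ubound_le (uboundB (uboundM (uboundB ubound1 uM) (hl n)) (uboundX n uM)).
  move: nd (exprn_ge0 n M0); set b := M ^+ n; rewrite ltr_pdivrMr// => nd b0.
  have bE : b = b / (1 - M) * (1 - M) by rewrite divfK//; lra.
  have c0 : 0 <= b / (1 - M) by rewrite divr_ge0//; lra.
  have : b / (1 - M) < d / 9 by rewrite ltr_pdivrMr.
  by move: bE c0; set c := b / (1 - M); nra.
by exists l; rewrite -lc.
Qed.

End UnitizationComplete.

(** * Square roots and spectral bounds *)

Lemma subDDl (V : zmodType) (x y z : V) : (x + y) - (x + z) = y - z.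
Proof. by rewrite (addrC x) addrKA. Qed.

Section Visser.
Context {R : realType} {B : cstarAlgType R}.
Local Notation U := (unitization B).
Implicit Types (u v d q : U) (M N e : R).

Lemma uboundZR (t : R) u M : 0 <= t -> ubound u M -> ubound (t%:C%C *: u) (t * M).
Proof. by move=> t0 uM; rewrite -{2}(ger0_norm t0) -nrmR; exact: uboundZ. Qed.

Lemma ubound_lim u M : (forall e, 0 < e -> ubound u (M + e)) -> ubound u M.
Proof.
move=> h; split=> [|y]; first by apply/ler_addgt0Pr => e /h[].
apply/ler_addgt0Pr => e e0.
have y0 := nrm_ge0 y.
have [_ /(_ y) hy] : ubound u (M + e / (nrm y + 1)) by apply: h; rewrite divr_gt0//; lra.
apply: le_trans hy _; rewrite mulrDl lerD2l mulrAC ler_pdivrMr; nra.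
Qed.

Lemma sqr1B u : (1 - u) ^+ 2 = 1 - (u *+ 2 - u ^+ 2).
Proof. by rewrite -sqrrN opprB sqrrB1 opprB addrC. Qed.

(* Visser's iteration q = (d + q^2) / 2, whose fixed points satisfy (1 - q)^2 = 1 - d;
   [visser_bound] is the scalar iteration at d = 1. *)
Fixpoint visser_bound n : R :=
  if n is n'.+1 then 2^-1 * (1 + visser_bound n' ^+ 2) else 0.

Fixpoint visser d n : U :=
  if n is n'.+1 then 2^-1%:C%C *: (d + visser d n' ^+ 2) else 0.

Lemma visser_bound_ge0 n : 0 <= visser_bound n.
Proof. by elim: n => //= n IH; rewrite mulr_ge0 ?addr_ge0 ?exprn_ge0 ?invr_ge0. Qed.

(** The gap t = 1 - b obeys t' = t - t^2 / 2, so it decays like 2 / n; the shift by 2 makes the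
    start t = 1 an equality. *)
Lemma visser_bound_cvg n : 0 <= 1 - visser_bound n <= 2 / n.+2%:R.
Proof.
elim: n => [|n]; first by rewrite /= subr0 ler01 divff ?pnatr_eq0//= lexx.
rewrite [visser_bound n.+1]/= -[n.+3%:R]natr1.
have := visser_bound_ge0 n; set b := visser_bound n => b0.
have : (2 : R) <= n.+2%:R by rewrite ler_nat.
set s : R := n.+2%:R => s2 /andP[b1]; rewrite ler_pdivlMr; last by lra.
move=> h; apply/andP; split; first by nra.
rewrite ler_pdivlMr; last by lra.
have d0 : 0 <= (1 - b) <= 1 by apply/andP; split; lra.
rewrite (_ : _ * _ = (1 - b) * (s + 1) - (1 - b) ^+ 2 * (s + 1) / 2); last by field.
suff : 0 <= (2 - (1 - b) * s) + ((1 - b) ^+ 2 * (s + 1) / 2 - (1 - b)) by lra.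
set t := 1 - b in b1 h d0 *.
have [ht|ht] := lerP (t * (s + 1)) 2; last by nra.
have : 0 <= (2 - t * (s + 1)) by lra.
nra.
Qed.

Lemma visser_bound_to1 e : 0 < e -> exists n, 1 - visser_bound n < e.
Proof.
move=> e0; exists (Num.bound (2 / e)).
have /andP[_ /le_lt_trans->//] := visser_bound_cvg (Num.bound (2 / e)).
rewrite ltr_pdivrMr ?ltr0n// mulrC -ltr_pdivrMr//.
have : 2 / e < (Num.bound (2 / e))%:R.
  by apply: archi_boundP; rewrite divr_ge0 ?ltW.
by move/lt_trans; apply; rewrite ltr_nat.
Qed.

Lemma visser_bound_le n : visser_bound n <= visser_bound n.+1.
Proof. by rewrite /=; set b := visser_bound n; have := sqr_ge0 (1 - b); nra. Qed.

Lemma ubound_visser d n : ubound d 1 -> ubound (visser d n) (visser_bound n).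
Proof.
move=> d1; elim: n => [|n IH]; first exact: ubound0.
by apply: uboundZR; rewrite ?invr_ge0//; apply: uboundD => //; exact: uboundX.
Qed.

Lemma ubound_subX2 u v M N e : ubound u M -> ubound v N -> ubound (u - v) e ->
  ubound (u ^+ 2 - v ^+ 2) ((M + N) * e).
Proof.
move=> uM vN uv; have -> : u ^+ 2 - v ^+ 2 = u * (u - v) + (u - v) * v.
  by rewrite !expr2 mulrBr mulrBl addrA subrK.
by rewrite [(M + N) * e]mulrDl [N * e]mulrC; apply: uboundD; exact: uboundM.
Qed.

(** The scalar iteration majorizes the increments: half of (b_m + b_n) (b_m - b_n) is the next
    scalar increment. *)
Lemma ubound_visserB d n m : ubound d 1 -> (n <= m)%N ->
  ubound (visser d m - visser d n) (visser_bound m - visser_bound n).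
Proof.
move=> d1; elim: n m => [|n IH] [|m]//= nm.
- by rewrite !subrr; exact: ubound0.
- by rewrite !subr0; exact: (ubound_visser m.+1).
rewrite -scalerBr -mulrBr !subDDl; apply: uboundZR; first by rewrite invr_ge0.
have := ubound_subX2 (ubound_visser m d1) (ubound_visser n d1) (IH m nm).
by apply: ubound_le; rewrite subr_sqr mulrC.
Qed.

(** Any fixed point of norm at most 1 is the limit of the iteration, with a rate independent of d.
    This is what later identifies a root known only to be positive. *)
Lemma ubound_visser_fix d q n : ubound d 1 -> ubound q 1 -> (1 - q) ^+ 2 = 1 - d ->
  ubound (q - visser d n) (1 - visser_bound n).
Proof.
move=> d1 q1 qd; elim: n => [|n IH]; first by rewrite /= !subr0.
have qE : q = 2^-1%:C%C *: (d + q ^+ 2).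
  have -> : d = q *+ 2 - q ^+ 2.
    by apply/oppr_inj/(@addrI _ 1); rewrite -qd sqr1B.
  rewrite subrK -[q *+ 2]scaler_nat scalerA -[X in _ = X *: _]/(2^-1%:C%C * 2%:R).
  have -> : (2%:R : R[i]) = 2%:C%C by rewrite rmorph_nat.
  by rewrite -rmorphM/= mulVf ?rmorph1 ?scale1r// pnatr_eq0.
rewrite {1}qE /= -scalerBr subDDl.
have -> : 1 - 2^-1 * (1 + visser_bound n ^+ 2) =
    2^-1 * ((1 + visser_bound n) * (1 - visser_bound n)).
  by field.
apply: uboundZR; rewrite ?invr_ge0//.
by apply: ubound_subX2 => //; exact: ubound_visser.
Qed.

Lemma visser_comm d v n : GRing.comm v d -> GRing.comm v (visser d n).
Proof.
move=> vd; elim: n => [|n IH] /=; first exact: commr0.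
by rewrite /GRing.comm -scalerAr -scalerAl; congr (_ *: _); apply: commrD => //; exact: commrX.
Qed.

Lemma visser_star d n : d^# = d -> (visser d n)^# = visser d n.
Proof.
move=> dd; elim: n => [|n IH] /=; first by congr pair; rewrite ?astar0 ?rmorph0.
rewrite astarZ astarD dd expr2 ustar_mul IH.
by congr (_ *: _); rewrite [_^*]conjc_real.
Qed.

(** The root is 1 - q with q the limit of the iteration; the norm bound, selfadjointness and
    commutation pass from the iterates to q. *)
Lemma usqrt d : ubound d 1 -> exists q,
  [/\ ubound q 1, (1 - q) ^+ 2 = 1 - d, d^# = d -> q^# = q &
      forall v, GRing.comm v d -> GRing.comm v q].
Proof.
move=> d1.
have [|q hq] := ubound_complete (u := visser d) (e := fun n => 1 - visser_bound n)
  _ visser_bound_to1.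
  move=> n m nm; apply: ubound_le (ubound_visserB d1 nm).
  by rewrite lerD2r; have := visser_bound_cvg m; lra.
have q1 : ubound q 1.
  apply: ubound_lim => e e0.
  have [n hn] := visser_bound_to1 (divr_gt0 e0 (ltr0n _ 4)).
  rewrite -(subrK (visser d n) q); apply: ubound_le (uboundD (hq n) (ubound_visser n d1)).
  have := visser_bound_cvg n; lra.
exists q; split=> //.
- apply/subr0_eq/ubound_eq0 => e e0.
  (* If g is the gap at n, the difference of squares costs at most 2 * 4 g, and twice the error at n
     + 1 costs at most 2 * 4 g as the gaps decrease. *)
  have [|n hn] := visser_bound_to1 (e := e / 16); first by rewrite divr_gt0.
  have -> : (1 - q) ^+ 2 - (1 - d) = (q ^+ 2 - visser d n ^+ 2) - 2%:C%C *: (q - visser d n.+1).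
    rewrite [visser d n.+1]/= scalerBr scalerA.
    rewrite -rmorphM/= mulfV ?rmorph1 ?scale1r ?pnatr_eq0//.
    have -> : (2%:C%C : R[i]) = 2%:R by rewrite rmorph_nat.
    rewrite scaler_nat sqr1B subDDl opprK !opprB.
    rewrite (addrC d) -(addrA _ d) [RHS]addrA subrK.
    by rewrite -addrA (addrC d).
  apply: ubound_le (uboundB (ubound_subX2 q1 (ubound_visser n d1) (hq n)) (uboundZR _ (hq n.+1))).
    have := visser_bound_le n; have := visser_bound_cvg n.+1; have := visser_bound_cvg n.
    by have := visser_bound_ge0 n; nra.
  by [].
- move=> dd; apply/subr0_eq/ubound_eq0 => e e0.
  have [|n hn] := visser_bound_to1 (e := e / 8); first by rewrite divr_gt0.
  have -> : q^# - q = (q - visser d n)^# - (q - visser d n).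
    by rewrite ustarB visser_star// opprB addrA subrK.
  by apply: ubound_le (uboundB (ubound_star (hq n)) (hq n)); lra.
- move=> v vd; apply: unif_cvg_comm hq _ (ubound_pair v) _ => [e e0|n].
    by have [|n hn] := visser_bound_to1 (e := e / 4); [rewrite divr_gt0|exists n; lra].
  exact: visser_comm.
Qed.

End Visser.

Section Positive.
Context {R : realType} {B : cstarAlgType R}.
Local Notation U := (unitization B).
Implicit Types (u v c : U) (M N e t : R).

Lemma commr_inv u v w : v * u = 1 -> u * v = 1 -> GRing.comm w u -> GRing.comm w v.
Proof.
by move=> vu uv wu; rewrite /GRing.comm -[w * v]mul1r -vu -!mulrA [u * _]mulrA -wu -mulrA uv mulr1.
Qed.

Lemma ustar_inv u v : v * u = 1 -> u * v = 1 -> u^# = u -> v^# = v.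
Proof.
move=> vu uv us; have : u * v^# = 1 by rewrite -us -ustar_mul vu ustar1.
by move/(congr1 ( *%R v)); rewrite mulrA vu mul1r mulr1.
Qed.

Lemma uinvertibleM u v : uinvertible u -> uinvertible v -> uinvertible (u * v).
Proof.
move=> [u' [uu uu']] [v' [vv vv']]; exists (v' * u'); split.
  by rewrite mulrA -(mulrA v') uu mulr1.
by rewrite mulrA -(mulrA u) vv' mulr1.
Qed.

Lemma uinvertibleZ (a : R[i]) u : a != 0 -> uinvertible u -> uinvertible (a *: u).
Proof.
move=> a0 [v [vu uv]]; exists (a^-1 *: v).
by rewrite -!scalerAl -!scalerAr !scalerA mulfV// mulVf// !scale1r.
Qed.

(* If c^2 + e^2 is the scalar M^2 then c is half the sum of M times a unitary and its adjoint. *)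
Lemma ubound_sqrD u v M : 0 <= M -> u^# = u -> v^# = v -> GRing.comm u v ->
  u ^+ 2 + v ^+ 2 = (M ^+ 2)%:C%C *: 1 -> ubound u M.
Proof.
move=> M0 us vs uv h; pose w := u + 'i *: v.
have ws : w^# = u - 'i *: v.
  by rewrite /w astarD astarZ us vs conjCi scaleNr.
have wM : ubound w M.
  apply: ubound_cstar => //.
  have -> : w^# * w = (M ^+ 2)%:C%C *: 1.
    rewrite -h !expr2 ws /w mulrDr !mulrBl -!scalerAr -!scalerAl uv addrA subrK scalerA.
    by rewrite -['i * 'i]expr2 sqrCi scaleN1r opprK.
  rewrite -[X in ubound _ X]mulr1; apply: uboundZR ubound1.
  by rewrite exprn_ge0.
have -> : u = 2^-1%:C%C *: (w + w^#).
  rewrite ws /w addrACA subrr addr0 -mulr2n -[u *+ 2]scaler_nat scalerA.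
  have -> : (2%:R : R[i]) = 2%:C%C by rewrite rmorph_nat.
  by rewrite -rmorphM/= mulVf ?rmorph1 ?scale1r// pnatr_eq0.
apply: ubound_le (uboundZR _ (uboundD wM (ubound_star wM))); last by rewrite invr_ge0.
by rewrite le_eqVlt; apply/orP; left; apply/eqP; field.
Qed.

(* With v = (1 - c^2)^-1 and e small, 1 - e - c^2 = (1 - c^2) (1 - e v) is the square of a
   selfadjoint element that commutes with c. *)
Lemma ubound_lt1 c : c^# = c -> ubound c 1 -> uinvertible (1 - c ^+ 2) ->
  exists2 M, M < 1 & ubound c M.
Proof.
move=> cs c1 [v [vc cv]].
have cc1 : ubound (c ^+ 2) 1 by rewrite -[X in ubound _ X](expr1n _ 2); exact: uboundX.
have ccs : (c ^+ 2)^# = c ^+ 2 by rewrite expr2 ustar_mul cs.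
have ccC : GRing.comm c (c ^+ 2) by exact: commrX.
have vs : v^# = v by apply: ustar_inv vc cv _; rewrite ustarB ustar1 ccs.
pose K := nrm v.1 + nrm (v.2 : R[i]^o).
have K0 : 0 <= K by rewrite addr_ge0 ?nrm_ge0.
(* K bounds v, so e K <= 1, as [usqrt] requires of e v; e <= 1 allows the real square root of 1 -
   e. *)
pose e := (K + 1)^-1.
have e0 : 0 < e by rewrite invr_gt0; lra.
have e1 : e <= 1 by rewrite invf_le1; lra.
pose d := e%:C%C *: v.
have ds : d^# = d by rewrite astarZ vs [_^*]conjc_real.
have d1 : ubound d 1.
  apply: ubound_le (uboundZR (ltW e0) (ubound_pair v)); rewrite -/K.
  by rewrite mulrC ler_pdivrMr; lra.
have cC : GRing.comm c d.
  rewrite /GRing.comm -scalerAr -scalerAl; congr (_ *: _).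
  by apply: commr_inv vc cv _; apply: commrB => //; exact: commr1.
have ccd : GRing.comm d (c ^+ 2) by apply/commrX/commr_sym.
have [q [_ q2 /(_ ccs) qs qC]] := usqrt cc1.
have [p [_ p2 /(_ ds) ps pC]] := usqrt d1.
have qp : GRing.comm q p by apply/pC/commr_sym/qC.
have sg : GRing.comm (1 - q) (1 - p).
  apply: commrB; first exact: commr1.
  by apply/commr_sym/commrB; [exact: commr1|exact/commr_sym].
have sq : Num.sqrt (1 - e) ^+ 2 = 1 - e by rewrite sqr_sqrtr// subr_ge0.
exists (Num.sqrt (1 - e)).
  rewrite -(ltr_pXn2r (n := 2)) ?nnegrE ?sqrtr_ge0// sq expr1n; lra.
apply: (@ubound_sqrD c ((1 - q) * (1 - p))) => //.
- by rewrite ustar_mul !ustarB ustar1 qs ps sg.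
- apply: commrM; apply: commrB; try exact: commr1.
    exact: qC.
  exact: pC.
rewrite exprMn_comm// q2 p2 mulrBr mulr1 -scalerAr cv sq rmorphB rmorph1 scalerBl scale1r.
by rewrite addrA addrCA subrr addr0.
Qed.

(** The infimum I of all bounds of c is again a bound. If I > r, then b = c / I makes 1 - b^2 = (1 -
    b) (1 + b) invertible, and [ubound_lt1] produces a bound of c below I. *)
Lemma ubound_spectral c r : c^# = c -> 0 <= r ->
  (forall t, r < t -> uinvertible (t%:C%C *: 1 - c) /\ uinvertible (t%:C%C *: 1 + c)) ->
  ubound c r.
Proof.
move=> cs r0 h.
pose E := [set M | ubound c M].
have E0 : E !=set0 by exists (nrm c.1 + nrm (c.2 : R[i]^o)); exact: ubound_pair.
have Elb : has_lbound E by exists 0 => M /ubound_ge0.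
have Einf : has_inf E by split.
have cI : ubound c (inf E).
  apply: ubound_lim => e e0; have [M EM Me] := inf_adherent e0 Einf.
  by apply: ubound_le EM; exact: ltW.
have [Ir|rI] := lerP (inf E) r; first exact: ubound_le cI.
exfalso; set I := inf E in cI rI *; have I0 : 0 < I by apply: le_lt_trans rI.
pose b := I^-1%:C%C *: c.
have IV : I%:C%C * I^-1%:C%C = 1 :> R[i] by rewrite -rmorphM/= mulfV ?gt_eqF// rmorph1.
have bs : b^# = b by rewrite astarZ cs [_^*]conjc_real.
have b1 : ubound b 1.
  by rewrite -(mulVf (lt0r_neq0 I0)); apply: uboundZR => //; rewrite invr_ge0 ltW.
have IVI : I^-1%:C%C * I%:C%C = 1 :> R[i] by rewrite mulrC.
have In0 : I^-1%:C%C != 0 :> R[i] by rewrite (inj_eq (@complexI R)) invr_eq0 gt_eqF.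
have bi : uinvertible (1 - b ^+ 2).
  rewrite -opprB subr_sqr_1 -mulNr opprB [b + 1]addrC.
  have [iB iD] := h _ rI.
  apply: uinvertibleM; rewrite -[1](scale1r (1 : U)) -IVI -scalerA -?scalerBr -?scalerDr.
    exact: uinvertibleZ.
  exact: uinvertibleZ.
have [M M1 bM] := ubound_lt1 bs b1 bi.
have : ubound c (I * M).
  have -> : c = I%:C%C *: b by rewrite scalerA IV scale1r.
  by apply: uboundZR bM; exact: ltW.
move/(ge_inf Elb); rewrite -/I; nra.
Qed.

End Positive.

(** * Positive elements *)

Section Order.
Context {R : realType} {B : cstarAlgType R}.
Local Notation U := (unitization B).
Implicit Types (u v c : U) (M N e t : R) (z : R[i]).

Lemma uinvertible_scalarB z u M : ubound u M -> M < nrm (z : R[i]^o) ->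
  uinvertible (z *: 1 - u).
Proof.
move=> uM Mz; have z0 : 0 < nrm (z : R[i]^o) by apply: le_lt_trans Mz; exact: ubound_ge0 uM.
have zn0 : z != 0 by apply: contraTneq z0 => ->; rewrite nrm0 ltxx.
have -> : z *: 1 - u = z *: (1 - z^-1 *: u) by rewrite scalerBr scalerA mulfV// scale1r.
apply: uinvertibleZ => //; apply: neumann (uboundZ _ uM) _.
have zz : nrm (z^-1 : R[i]^o) * nrm (z : R[i]^o) = 1.
  by rewrite -nrmM mulVf// (nrmR 1) normr1.
rewrite -zz ltr_pM2l// lt_def nrm_ge0 andbT; apply/eqP => zV0.
by move: zz; rewrite zV0 mul0r => /esym/eqP; rewrite oner_eq0.
Qed.

Lemma uinvertibleN u : uinvertible u -> uinvertible (- u).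
Proof. by rewrite -scaleN1r; apply: uinvertibleZ; rewrite oppr_eq0 oner_neq0. Qed.

Lemma upositive_uinvertible u t : upositive u -> 0 < t -> uinvertible (t%:C%C *: 1 + u).
Proof.
move=> [_ up] t0; rewrite -[_ + _]opprK opprD -scaleNr; apply: uinvertibleN.
apply: contrapT => /up /=; rewrite -rmorphN/= ler0c oppr_ge0; lra.
Qed.

(** For s > t, the element s - (t - u) = (s - t) + u is invertible by positivity, and s + (t - u) =
    (s + t) - u by a Neumann series, since s + t > 2 t >= M. *)
Lemma upositive_ubound u M t : upositive u -> ubound u M -> M <= 2 * t ->
  ubound (t%:C%C *: 1 - u) t.
Proof.
move=> up uM Mt; have M0 := ubound_ge0 uM.
apply: ubound_spectral => [||s ts].
- by rewrite ustarB astarZ ustar1 [_^*]conjc_real; case: up => ->.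
- by lra.
split.
- rewrite opprB addrA addrAC -scalerBl -rmorphB; apply: upositive_uinvertible => //.
  by rewrite subr_gt0.
- rewrite addrA -scalerDl -rmorphD; apply: uinvertible_scalarB uM _.
  by rewrite nrmR ger0_norm; lra.
Qed.

(* Arens: translating by an imaginary scalar changes the norm of a selfadjoint element less than it
   changes the modulus of a spectral value off the real line. *)
Lemma sa_uinvertible u z : u^# = u -> complex.Im z != 0 -> uinvertible (z *: 1 - u).
Proof.
move=> us Iz; pose M := nrm u.1 + nrm (u.2 : R[i]^o); have uM : ubound u M := ubound_pair u.
(* Chosen so that 2 g Im z = M^2 + 1: then |z + i g|^2 exceeds M^2 + g^2, a bound for the square of
   the norm of u + i g. *)
pose g := (M ^+ 2 + 1) / (2 * complex.Im z).
pose s : R[i] := (0 +i* g)%C.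
have -> : z *: 1 - u = (z + s) *: 1 - (u + s *: 1).
  by rewrite scalerDl opprD addrACA subrr addr0.
have sJ : s^* = - s by rewrite [s^*]/= /s; apply/eqP; rewrite eq_complex /= oppr0 !eqxx.
have ss : s * s = - (g ^+ 2)%:C%C.
  by apply/eqP; rewrite eq_complex /= !mul0r !mulr0 sub0r addr0 oppr0 expr2 !eqxx.
apply: (@uinvertible_scalarB _ _ (Num.sqrt (M ^+ 2 + g ^+ 2))).
  apply: ubound_cstar; first exact: sqrtr_ge0.
  rewrite sqr_sqrtr ?addr_ge0 ?sqr_ge0//.
  have -> : (u + s *: 1)^# * (u + s *: 1) = u ^+ 2 + (g ^+ 2)%:C%C *: 1.
    rewrite astarD astarZ us ustar1 sJ scaleNr mulrDr !mulrBl -!scalerAr -!scalerAl !mulr1 !mul1r.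
    by rewrite addrA subrK scalerA ss scaleNr opprK expr2.
  apply: uboundD; first exact: uboundX.
  by rewrite -[X in ubound _ X]mulr1; apply: uboundZR ubound1; rewrite sqr_ge0.
rewrite -(ltr_pXn2r (n := 2)) ?nnegrE ?nrm_ge0 ?sqrtr_ge0//.
rewrite sqr_sqrtr ?addr_ge0 ?sqr_ge0// nrm_sqr !raddfD/= addr0.
have gE : 2 * complex.Im z * g = M ^+ 2 + 1 by rewrite mulrC divfK// mulf_neq0// pnatr_eq0.
have := sqr_ge0 (complex.Re z); have := sqr_ge0 (complex.Im z).
by move: gE; set a := complex.Re z; set b := complex.Im z; nra.
Qed.

(** If M bounds both, M - u and M - v are bounded by M, so 2 M - (u + v) is bounded by 2 M. For real
    z < 0 this is less than 2 M - z, and a Neumann series inverts z - (u + v). *)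
Lemma upositiveD u v : upositive u -> upositive v -> upositive (u + v).
Proof.
move=> up vp; have [us _] := up; have [vs _] := vp.
have ws : (u + v)^# = u + v by rewrite astarD us vs.
split=> // z zs /=; apply: contrapT => zn; apply: zs.
have [Iz|Iz] := eqVneq (complex.Im z) 0; last exact: sa_uinvertible.
have zE : z = (complex.Re z)%:C%C by apply/eqP; rewrite eq_complex /= Iz !eqxx.
have z0 : complex.Re z < 0 by rewrite ltNge -ler0c -zE; apply/negP.
pose M := nrm u.1 + nrm (u.2 : R[i]^o) + (nrm v.1 + nrm (v.2 : R[i]^o)).
have uM : ubound u M by apply: ubound_le (ubound_pair u); rewrite lerDl addr_ge0 ?nrm_ge0.
have vM : ubound v M by apply: ubound_le (ubound_pair v); rewrite lerDr addr_ge0 ?nrm_ge0.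
have M0 := ubound_ge0 uM.
have M2 : M <= 2 * M by lra.
have := uboundD (upositive_ubound up uM M2) (upositive_ubound vp vM M2).
rewrite addrACA -scalerDl -opprD => h.
have -> : z *: 1 - (u + v) =
    - ((M%:C%C + M%:C%C - z) *: 1 - ((M%:C%C + M%:C%C) *: 1 - (u + v))).
  by rewrite [(_ - z) *: _]scalerBl opprB subDDl opprK addrC.
apply/uinvertibleN/(uinvertible_scalarB h).
rewrite zE -rmorphD -rmorphB nrmR ger0_norm; lra.
Qed.

Lemma ale_trans (x y w : B) : ale x y -> ale y w -> ale x w.
Proof.
move=> xy yw; have := upositiveD xy yw.
by rewrite -uembD addrC subrKA.
Qed.

Lemma tails_filter (Lam : set B) : upward_directed Lam -> ProperFilter (tails Lam).
Proof.
move=> [[h0 Lh0] Ldir]; apply: filter_from_proper.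
  apply: filter_from_filter; first by exists h0.
  move=> h1 h2 L1 L2; have [h3 [L3 h13 h23]] := Ldir _ _ L1 L2.
  exists h3 => // h [Lh h3h]; split; split=> //; exact: ale_trans h3h.
(* Directedness applied to the pair (h, h) gives a point in the tail of h. *)
by move=> h Lh; have [h3 [L3 hh _]] := Ldir _ _ Lh Lh; exists h3.
Qed.

End Order.

(** * Closed ideals of [B] inside the unitization *)

Section Ideals.
Context {R : realType} {B : cstarAlgType R}.
Local Notation U := (unitization B).
Implicit Types (J : set B) (u v : U) (x y : B).

Lemma closed_ideal_lim J x : closed_ideal J ->
  (forall e : R, 0 < e -> exists2 j, J j & nrm (x - j) <= e) -> J x.
Proof.
move=> [_ _ _ _ cJ] h; apply: cJ => A /nbhs_normP[e e0 eA].
have eE : e = (complex.Re e)%:C%C by rewrite RRe_real// gtr0_real.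
have e20 : 0 < complex.Re e / 2 by rewrite divr_gt0// -ltcR -eE.
have [j Jj xj] := h _ e20; exists j; split => //; apply: eA => /=.
by rewrite nrmE eE ltcR; lra.
Qed.

Definition uideal J : set U := [set u | J u.1 /\ u.2 = 0].

Section ClosedIdeal.
Variable J : set B.
Hypothesis Jideal : closed_ideal J.

Lemma idealN x : J x -> J (- x).
Proof. by case: Jideal => _ _ JZ _ _ Jx; rewrite -scaleN1r; exact: JZ. Qed.

Lemma uideal0 : uideal J 0.
Proof. by case: Jideal. Qed.

Lemma uidealD u v : uideal J u -> uideal J v -> uideal J (u + v).
Proof.
case: Jideal => _ JD _ _ _ [Ju u0] [Jv v0].
by split; [exact: JD|rewrite /= u0 v0 addr0].
Qed.

Lemma uidealZ (c : R[i]) u : uideal J u -> uideal J (c *: u).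
Proof. by case: Jideal => _ _ JZ _ _ [Ju u0]; split; [exact: JZ|rewrite /= u0 scaler0]. Qed.

Lemma uidealN u : uideal J u -> uideal J (- u).
Proof. by rewrite -scaleN1r; exact: uidealZ. Qed.

Lemma uidealB u v : uideal J u -> uideal J v -> uideal J (u - v).
Proof. by move=> Ju Jv; apply: uidealD => //; exact: uidealN. Qed.

Lemma uidealMl u v : uideal J v -> uideal J (u * v).
Proof.
case: Jideal => _ JD JZ JM _ [Jv v0]; split; last by rewrite /= v0 mulr0.
rewrite /= v0 scale0r addr0; apply: JD; last exact: JZ.
by case: (JM u.1 v.1 Jv).
Qed.

Lemma uidealMr u v : uideal J u -> uideal J (u * v).
Proof.
case: Jideal => _ JD JZ JM _ [Ju u0]; split; last by rewrite /= u0 mul0r.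
rewrite /= u0 scale0r addr0; apply: JD; last exact: JZ.
by case: (JM v.1 u.1 Ju).
Qed.

Lemma uideal_emb x : uideal J (uemb x) <-> J x.
Proof. by split=> [[]|]. Qed.

Lemma uideal_lim u :
  (forall e : R, 0 < e -> exists2 v, uideal J v & ubound (u - v) e) -> uideal J u.
Proof.
move=> h; split.
  apply: closed_ideal_lim => // e e0; have [|v [Jv _] /ubound_fst] := h (e / 2).
    by rewrite divr_gt0.
  by rewrite mulrC divfK// => ?; exists v.1.
apply: nrm_eq0; apply/le_anti; rewrite nrm_ge0 andbT; apply/ler_addgt0Pl => e e0.
by have [v [_ v0] [+ _]] := h e e0; rewrite /= v0 subr0 addr0.
Qed.

Lemma uideal_visser d n : uideal J d -> uideal J (visser d n).
Proof.
move=> Jd; elim: n => [|n IH]; first exact: uideal0.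
by apply/uidealZ/uidealD => //; rewrite expr2; exact: uidealMl.
Qed.

End ClosedIdeal.

(** * The positive square root k of 1 - h^2 *)

Section PositiveRoot.
Variables (h : B) (k : U).
Hypotheses (hpos : apositive h) (h1 : nrm h <= 1) (hk : is_psqrt (uone - uemb (h ** h)) k).

Lemma psqrt_star : k^# = k. Proof. by case: hk => -[]. Qed.

Lemma apositive_star : (uemb h)^# = uemb h :> U. Proof. by case: hpos. Qed.

Lemma psqrt_sqr : k * k = 1 - uemb h * uemb h.
Proof. by rewrite -uembM; case: hk. Qed.

Lemma ubound_uemb : ubound (uemb h) 1.
Proof. exact: ubound_le (ubound_emb h). Qed.

(** This crude bound is what [upositive_ubound] with t = 1 asks for in order to give |1 - k| <=
    1. *)
Lemma ubound_psqrt : ubound k 2.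
Proof.
apply: ubound_cstar => //; rewrite psqrt_star psqrt_sqr.
by apply: ubound_le (uboundB ubound1 (uboundM ubound_uemb ubound_uemb)); lra.
Qed.

(** The contraction 1 - k solves (1 - q)^2 = 1 - h^2, hence is approximated by polynomials in h^2 at
    a rate that does not depend on h. *)
Lemma psqrt_visser n : ubound (1 - k - visser (uemb h ^+ 2) n) (1 - visser_bound n).
Proof.
apply: ubound_visser_fix.
- by rewrite -[X in ubound _ X](expr1n _ 2); exact: uboundX ubound_uemb.
- have := upositive_ubound (t := 1) (proj1 hk) ubound_psqrt.
  by rewrite rmorph1 scale1r; apply; lra.
- by rewrite opprB addrC subrK !expr2 psqrt_sqr.
Qed.

Lemma psqrt_comm : GRing.comm (uemb h) k.
Proof.
rewrite -[k](subKr 1); apply: commrB; first exact: commr1.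
apply: (unif_cvg_comm psqrt_visser visser_bound_to1 ubound_uemb) => n.
by apply: visser_comm; exact: commrX.
Qed.

(** The approximating polynomials in h^2 have no constant term, so they lie in J, and J is
    closed. *)
Lemma psqrt_uideal J : closed_ideal J -> J h -> uideal J (1 - k).
Proof.
move=> Ji Jh; apply: uideal_lim => // e e0.
have [n ne] := visser_bound_to1 e0; exists (visser (uemb h ^+ 2) n).
  by apply: uideal_visser => //; rewrite expr2; apply: uidealMl => //; exact/uideal_emb.
by apply: ubound_le (psqrt_visser n); exact: ltW.
Qed.

End PositiveRoot.
End Ideals.

(** * Nets modulo null nets *)

Section BoundedNets.
Context {R : realType} {B : cstarAlgType R}.
Variable Lam : set B.
Local Notation U := (unitization B).

Definition bounded_net (F : B -> U) := exists M : R, forall h, Lam h -> ubound (F h) M.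

(** Bounded nets form a ring with involution, and null nets absorb products with them. The bound is
    only required on [Lam], while equality of nets means equality on all of [B]. *)
Record bnet := BNet { bnet_val :> B -> U; bnetP : bounded_net bnet_val }.

Lemma bnetE (F G : bnet) : (forall h, F h = G h) -> F = G.
Proof.
case: F G => [F bF] [G bG] /= /funext FG.
by rewrite {F}FG in bF *; congr BNet; exact: Prop_irrelevance.
Qed.

HB.instance Definition _ := gen_eqMixin bnet.
HB.instance Definition _ := gen_choiceMixin bnet.

Fact bnet_const_subproof (u : U) : bounded_net (fun=> u).
Proof. by exists (nrm u.1 + nrm (u.2 : R[i]^o)) => h _; exact: ubound_pair. Qed.

Fact bnet_add_subproof (F G : bnet) : bounded_net (fun h => F h + G h).
Proof.
have [M FM] := bnetP F; have [N GN] := bnetP G; exists (M + N) => h Lh.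
exact: uboundD (FM h Lh) (GN h Lh).
Qed.

Fact bnet_opp_subproof (F : bnet) : bounded_net (fun h => - F h).
Proof. by have [M FM] := bnetP F; exists M => h Lh; exact: uboundN (FM h Lh). Qed.

Fact bnet_mul_subproof (F G : bnet) : bounded_net (fun h => F h * G h).
Proof.
have [M FM] := bnetP F; have [N GN] := bnetP G; exists (M * N) => h Lh.
exact: uboundM (FM h Lh) (GN h Lh).
Qed.

Definition bnet_cst u := BNet (bnet_const_subproof u).
Definition bnet_add F G := BNet (bnet_add_subproof F G).
Definition bnet_opp F := BNet (bnet_opp_subproof F).
Definition bnet_mul F G := BNet (bnet_mul_subproof F G).

Fact bnet_addA : associative bnet_add.
Proof. by move=> F G H; apply: bnetE => h /=; rewrite addrA. Qed.

Fact bnet_addC : commutative bnet_add.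
Proof. by move=> F G; apply: bnetE => h /=; rewrite addrC. Qed.

Fact bnet_add0 : left_id (bnet_cst 0) bnet_add.
Proof. by move=> F; apply: bnetE => h /=; rewrite add0r. Qed.

Fact bnet_addN : left_inverse (bnet_cst 0) bnet_opp bnet_add.
Proof. by move=> F; apply: bnetE => h /=; rewrite addNr. Qed.

Fact bnet_mulA : associative bnet_mul.
Proof. by move=> F G H; apply: bnetE => h /=; rewrite mulrA. Qed.

Fact bnet_mul1 : left_id (bnet_cst 1) bnet_mul.
Proof. by move=> F; apply: bnetE => h /=; rewrite mul1r. Qed.

Fact bnet_mulr1 : right_id (bnet_cst 1) bnet_mul.
Proof. by move=> F; apply: bnetE => h /=; rewrite mulr1. Qed.

Fact bnet_mulDl : left_distributive bnet_mul bnet_add.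
Proof. by move=> F G H; apply: bnetE => h /=; rewrite mulrDl. Qed.

Fact bnet_mulDr : right_distributive bnet_mul bnet_add.
Proof. by move=> F G H; apply: bnetE => h /=; rewrite mulrDr. Qed.

HB.instance Definition _ := GRing.isPzRing.Build bnet bnet_addA bnet_addC bnet_add0
  bnet_addN bnet_mulA bnet_mul1 bnet_mulr1 bnet_mulDl bnet_mulDr.

Fact bnet_star_subproof (F : bnet) : bounded_net (fun h => (F h)^#).
Proof.
have [M FM] := bnetP F; exists M => h Lh.
exact: ubound_star (FM h Lh).
Qed.

Definition bnet_star (F : bnet) : bnet := BNet (bnet_star_subproof F).

Definition bnet_const (x : B) : bnet := bnet_cst (uemb x).

Lemma bnet_constM x y : bnet_const (x ** y) = bnet_const x * bnet_const y.
Proof. by apply: bnetE => h; exact: uembM. Qed.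

Lemma bnet_constD x y : bnet_const (x + y) = bnet_const x + bnet_const y.
Proof. by apply: bnetE => h; exact: uembD. Qed.

Lemma bnet_star_const x : bnet_star (bnet_const x) = bnet_const x^#.
Proof. by apply: bnetE => h /=; rewrite uemb_star. Qed.

Lemma bnet_starM F G : bnet_star (F * G) = bnet_star G * bnet_star F.
Proof. by apply: bnetE => h; exact: ustar_mul. Qed.

Lemma bnet_starD F G : bnet_star (F + G) = bnet_star F + bnet_star G.
Proof. by apply: bnetE => h; exact: astarD. Qed.

(** The relation x ≈ 0 of the statement, for nets in the unitization, where k takes its values. *)
Definition null_net (J : set B) (F : B -> U) :=
  (forall h, Lam h -> uideal J (F h)) /\
  (forall e : R, 0 < e -> \forall h \near tails Lam, ubound (F h) e).

Section NullNets.
Variable J : set B.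
Hypothesis Jideal : closed_ideal J.
Hypothesis Ldir : upward_directed Lam.

Let tails_proper : ProperFilter (tails Lam).
Proof. exact: tails_filter. Qed.
#[local] Existing Instance tails_proper.

Lemma near_tails : \forall h \near tails Lam, Lam h.
Proof. by case: Ldir => [[h0 Lh0] _]; exists h0 => // h []. Qed.

Lemma null_net0 : null_net J (fun=> 0).
Proof.
split=> [h _|e e0]; first exact: uideal0.
by apply: nearW => h; apply: ubound_le ubound0; exact: ltW.
Qed.

Lemma null_netD F G : null_net J F -> null_net J G -> null_net J (fun h => F h + G h).
Proof.
move=> [FJ F0] [GJ G0]; split=> [h Lh|e e0]; first exact: uidealD (FJ h Lh) (GJ h Lh).
have e20 : 0 < e / 2 by rewrite divr_gt0.
apply: filterS2 (F0 _ e20) (G0 _ e20) => h Fh Gh.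
by rewrite (splitr e); exact: uboundD Fh Gh.
Qed.

Lemma null_netN F : null_net J F -> null_net J (fun h => - F h).
Proof.
move=> [FJ F0]; split=> [h Lh|e e0]; first exact: uidealN (FJ h Lh).
by apply: filterS (F0 _ e0) => h Fh; exact: uboundN Fh.
Qed.

Lemma null_netMl (G : bnet) F : null_net J F -> null_net J (fun h => G h * F h).
Proof.
move=> [FJ F0]; split=> [h Lh|e e0]; first exact: uidealMl (FJ h Lh).
have [M GM] := bnetP G.
have [h0 Lh0] : Lam !=set0 by case: Ldir.
have M0 := ubound_ge0 (GM _ Lh0).
have eM : 0 < e / (M + 1) by rewrite divr_gt0//; lra.
apply: filterS2 (F0 _ eM) near_tails => h Fh Lh.
apply: ubound_le (uboundM (GM h Lh) Fh).
by rewrite mulrA ler_pdivrMr; nra.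
Qed.

Lemma null_netMr (G : bnet) F : null_net J F -> null_net J (fun h => F h * G h).
Proof.
move=> [FJ F0]; split=> [h Lh|e e0]; first exact: uidealMr (FJ h Lh).
have [M GM] := bnetP G.
have [h0 Lh0] : Lam !=set0 by case: Ldir.
have M0 := ubound_ge0 (GM _ Lh0).
have eM : 0 < e / (M + 1) by rewrite divr_gt0//; lra.
apply: filterS2 (F0 _ eM) near_tails => h Fh Lh.
apply: ubound_le (uboundM Fh (GM h Lh)).
by rewrite mulrAC ler_pdivrMr; nra.
Qed.

Lemma null_net_star F : (forall x, J x -> J x^#) ->
  null_net J F -> null_net J (fun h => (F h)^#).
Proof.
move=> JS [FJ F0]; split=> [h Lh|e e0].
  by have [Fh F2] := FJ h Lh; split; [exact: JS|rewrite /= F2 rmorph0].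
by apply: filterS (F0 _ e0) => h Fh; exact: ubound_star.
Qed.

Definition bnet_eqv (F G : bnet) := null_net J (fun h => F h - G h).

Lemma bnet_eqv_refl F : bnet_eqv F F.
Proof.
have := null_net0; rewrite /bnet_eqv; congr null_net.
by apply/funext => h; rewrite subrr.
Qed.

Lemma bnet_eqv_sym F G : bnet_eqv F G -> bnet_eqv G F.
Proof.
move/null_netN; rewrite /bnet_eqv; congr null_net.
by apply/funext => h; rewrite opprB.
Qed.

Lemma bnet_eqv_trans F G H : bnet_eqv F G -> bnet_eqv G H -> bnet_eqv F H.
Proof.
move=> FG GH; have := null_netD FG GH; rewrite /bnet_eqv; congr null_net.
by apply/funext => h; rewrite subrKA.
Qed.

Lemma bnet_eqvD F G F' G' : bnet_eqv F G -> bnet_eqv F' G' -> bnet_eqv (F + F') (G + G').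
Proof.
move=> FG FG'; have := null_netD FG FG'; rewrite /bnet_eqv; congr null_net.
by apply/funext => h; rewrite addrACA -opprD.
Qed.

Lemma bnet_eqvM F G F' G' : bnet_eqv F G -> bnet_eqv F' G' -> bnet_eqv (F * F') (G * G').
Proof.
move=> FG FG'; apply: (@bnet_eqv_trans _ (F * G')).
  have := null_netMl F FG'; rewrite /bnet_eqv; congr null_net.
  by apply/funext => h; rewrite mulrBr.
have := null_netMr G' FG; rewrite /bnet_eqv; congr null_net.
by apply/funext => h; rewrite mulrBl.
Qed.

Lemma bnet_eqv_star F G : (forall x, J x -> J x^#) ->
  bnet_eqv F G -> bnet_eqv (bnet_star F) (bnet_star G).
Proof.
move=> JS /(null_net_star JS); rewrite /bnet_eqv; congr null_net.
by apply/funext => h; exact: ustarB.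
Qed.

Lemma approx_mod_bnet (f g : B -> B) (F G : bnet) :
  (forall h, Lam h -> F h = uemb (f h)) -> (forall h, Lam h -> G h = uemb (g h)) ->
  bnet_eqv F G -> approx_mod J Lam f g.
Proof.
move=> Ff Gg [FGJ FG0]; have E h : Lam h -> F h - G h = uemb (f h - g h).
  by move=> Lh; rewrite Ff// Gg// uembB.
split=> [h Lh|]; first by apply/uideal_emb; rewrite -E//; exact: FGJ.
apply/cvg_nrmP => e e0; have e20 : 0 < e / 2 by rewrite divr_gt0.
apply: filterS2 (FG0 _ e20) near_tails => h + Lh.
by rewrite [X in ubound X _]E// => /ubound_embW; rewrite sub0r nrmN; lra.
Qed.

End NullNets.

End BoundedNets.

(** * The nets h and k of a quasi-central approximate unit *)

Section QuasiCentral.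
Context {R : realType} {B : cstarAlgType R}.
Local Notation U := (unitization B).
Variables (J Lam : set B) (k : B -> U).
Hypothesis Jideal : closed_ideal J.
Hypothesis Lqc : quasi_central_approximate_unit J Lam.
Hypothesis kroot : forall h, Lam h -> is_psqrt (uone - uemb (h ** h)) (k h).

Let Ldir : upward_directed Lam. Proof. by case: Lqc => -[]. Qed.
Let tails_proper : ProperFilter (tails Lam). Proof. exact: tails_filter. Qed.
#[local] Existing Instance tails_proper.

Let LJ h : Lam h -> J h. Proof. by case: Lqc => -[_ + _] _ => /[apply]-[]. Qed.
Let Lpos h : Lam h -> apositive h. Proof. by case: Lqc => -[_ + _] _ => /[apply]-[]. Qed.
Let L1 h : Lam h -> nrm h <= 1.
Proof. by case: Lqc => -[_ + _] _ => /[apply]-[_ _]; rewrite nrm_leP rmorph1. Qed.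
Let Lstar h : Lam h -> h^# = h.
Proof. by move/Lpos/apositive_star; rewrite -uemb_star => /uemb_inj. Qed.

Let JM x y : J y -> J (x ** y) /\ J (y ** x).
Proof. by case: Jideal => _ _ _ + _; apply. Qed.

Let tails_cvg (f : B -> B) l (e : R) : f h @[h --> tails Lam] --> l -> 0 < e ->
  \forall h \near tails Lam, Lam h /\ nrm (l - f h) < e.
Proof. by move=> /cvg_nrmP fl /fl; exact: filterI (near_tails Ldir). Qed.

(** Since h x tends to x, its adjoint x^# h, which lies in J, tends to x^#. *)
Lemma ideal_star x : J x -> J x^#.
Proof.
move=> Jx; apply: closed_ideal_lim => // e e0.
have [hx _] : h ** x @[h --> tails Lam] --> x /\ x ** h @[h --> tails Lam] --> x.
  by case: Lqc => -[_ _ +] _; apply.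
have [h [Lh hxe]] := filter_ex (tails_cvg hx e0).
exists (x^# ** h); first by have [] := JM x^# (LJ Lh).
by rewrite -{1}(Lstar Lh) -astarM -astarB nrm_star ltW.
Qed.

(** With p = x^# x in J, |x - x h|^2 = |(1 - h) (p - p h)| <= 2 |p - p h| tends to 0, so x is a
    limit of the elements x h of J. *)
Lemma ideal_cstar x : J (x^# ** x) -> J x.
Proof.
move=> Jx; apply: closed_ideal_lim => // e e0; set p := x^# ** x in Jx.
have [_ hx] : h ** p @[h --> tails Lam] --> p /\ p ** h @[h --> tails Lam] --> p.
  by case: Lqc => -[_ _ +] _; apply.
have ee0 : 0 < e ^+ 2 / 2 by rewrite divr_gt0// exprn_gt0.
have [h [Lh hxe]] := filter_ex (tails_cvg hx ee0).
exists (x ** h); first by have [] := JM x (LJ Lh).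
rewrite -(ler_pXn2r (n := 2)) ?nnegrE ?nrm_ge0 ?(ltW e0)// -nrm_cstar.
have -> : (x - x ** h)^# ** (x - x ** h) = (p - p ** h) - h ** (p - p ** h).
  by rewrite astarB astarM (Lstar Lh) !amulBl !amulBr !amulA.
have := nrm_amul h (p - p ** h); have := nrmB (p - p ** h) (h ** (p - p ** h)).
have := L1 Lh; have := nrm_ge0 (p - p ** h); have := nrm_ge0 h; nra.
Qed.

Fact unit_net_bounded : bounded_net Lam (fun h => uemb h).
Proof. by exists 1 => h Lh; exact: ubound_uemb (L1 Lh). Qed.

Fact root_net_bounded : bounded_net Lam k.
Proof. by exists 2 => h Lh; exact: ubound_psqrt (L1 Lh) (kroot Lh). Qed.

Definition unit_net := BNet unit_net_bounded.
Definition root_net := BNet root_net_bounded.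

Local Notation H := unit_net.
Local Notation K := root_net.
Local Notation c := (bnet_const Lam).
Local Notation "F ~= G" := (bnet_eqv J F G) (at level 70).

(** With the next three instances, equality modulo null nets is a congruence for sum, product and
    adjoint, and can be used for rewriting. *)
#[local] Instance bnet_eqv_equivalence : RelationClasses.Equivalence (@bnet_eqv R B Lam J).
Proof.
split=> [F|F G|F G L]; first exact: bnet_eqv_refl.
- exact: bnet_eqv_sym.
- exact: bnet_eqv_trans.
Qed.

#[local] Instance bnet_add_proper : Morphisms.Proper
  (Morphisms.respectful (@bnet_eqv R B Lam J)
    (Morphisms.respectful (@bnet_eqv R B Lam J) (@bnet_eqv R B Lam J))) +%R.
Proof. by move=> F G FG F' G' FG'; exact: bnet_eqvD. Qed.

#[local] Instance bnet_mul_proper : Morphisms.Proper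
  (Morphisms.respectful (@bnet_eqv R B Lam J)
    (Morphisms.respectful (@bnet_eqv R B Lam J) (@bnet_eqv R B Lam J))) *%R.
Proof. by move=> F G FG F' G' FG'; exact: bnet_eqvM. Qed.

#[local] Instance bnet_star_proper : Morphisms.Proper
  (Morphisms.respectful (@bnet_eqv R B Lam J) (@bnet_eqv R B Lam J)) (@bnet_star R B Lam).
Proof. by move=> F G FG; apply: bnet_eqv_star => //; exact: ideal_star. Qed.

Lemma bnet_eqv_on (F G : bnet Lam) : (forall h, Lam h -> F h = G h) -> F ~= G.
Proof.
move=> FG; split=> [h Lh|e e0]; first by rewrite FG// subrr; exact: uideal0.
apply: filterS (near_tails Ldir) => h Lh.
by rewrite FG// subrr; exact: ubound_le (ltW e0) ubound0.
Qed.

Lemma unit_net_star : bnet_star H ~= H.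
Proof. by apply: bnet_eqv_on => h Lh; exact: apositive_star (Lpos Lh). Qed.

Lemma root_net_star : bnet_star K ~= K.
Proof. by apply: bnet_eqv_on => h Lh; exact: psqrt_star (kroot Lh). Qed.

Lemma unit_root_comm : K * H ~= H * K.
Proof. by apply: bnet_eqv_on => h Lh; rewrite /= (psqrt_comm (L1 Lh) (kroot Lh)). Qed.

Lemma unit_root_sqr : H * H + K * K ~= 1.
Proof. by apply: bnet_eqv_on => h Lh /=; rewrite (psqrt_sqr (kroot Lh)) addrC subrK. Qed.

Lemma unit_net_central x : c x * H ~= H * c x.
Proof.
symmetry; split=> [h Lh|e e0] /=.
  by apply: uidealB => //; [apply: uidealMr|apply: uidealMl] => //; apply/uideal_emb/LJ.
have [_ /(_ x) hx] := Lqc; apply: filterS (tails_cvg hx e0) => h [_].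
rewrite sub0r nrmN -!uembM -uembB => /ltW; move: (h ** x - x ** h) => y ye.
exact: ubound_le ye (ubound_emb y).
Qed.

Fact visser_net_bounded n : bounded_net Lam (fun h => visser (uemb h ^+ 2) n).
Proof.
exists (visser_bound n) => h Lh; apply: ubound_visser.
by rewrite -[X in ubound _ X](expr1n _ 2); exact: uboundX (ubound_uemb (L1 Lh)).
Qed.

Lemma visser_net_central n x :
  c x * BNet (visser_net_bounded n) ~= BNet (visser_net_bounded n) * c x.
Proof.
elim: n => [|n IH]; first by apply: bnet_eqv_on => h _; rewrite /= mulr0 mul0r.
set V := BNet (visser_net_bounded n) in IH *.
pose t : bnet Lam := bnet_cst Lam (2^-1%:C%C *: 1).
have tC F : F * t = t * F.
  by apply: bnetE => h; rewrite /= -scalerAr -scalerAl mulr1 mul1r.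
have -> : BNet (visser_net_bounded n.+1) = t * (H * H + V * V).
  by apply: bnetE => h; rewrite /= -scalerAl mul1r !expr2.
rewrite mulrA tC -!mulrA mulrDr mulrDl !mulrA.
rewrite unit_net_central -[H * c x * H]mulrA unit_net_central.
rewrite IH -[V * c x * V]mulrA IH !mulrA.
reflexivity.
Qed.

(** For u = k this expresses the commutator through 1 - k, which lies in J and is approximated by
    polynomials in h^2. *)
Let commutator_sub1 (u v : U) : u * v - v * u = v * (1 - u) - (1 - u) * v.
Proof. by rewrite mulrBr mulrBl mulr1 mul1r opprB [RHS]addrC addrA subrK. Qed.

Lemma root_net_central x : c x * K ~= K * c x.
Proof.
symmetry; split=> [h Lh|e e0] /=.
  rewrite commutator_sub1.
  have Jk := psqrt_uideal (L1 Lh) (kroot Lh) Jideal (LJ Lh).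
  by apply: uidealB => //; [exact: uidealMl|exact: uidealMr].
have x0 := nrm_ge0 x.
(* Replacing 1 - k by its polynomial costs at most 2 |x| times the gap, less than e / 2; the
   commutator with the polynomial takes the other half of e. *)
have [|n ne] := visser_bound_to1 (e := e / (4 * (nrm x + 1))).
  by rewrite divr_gt0// mulr_gt0//; lra.
have [_ /(_ (e / 2))] := visser_net_central n x.
rewrite divr_gt0// => /(_ isT); apply: filterS2 (near_tails Ldir) => h Lh /= Vh.
have Vk := psqrt_visser (L1 Lh) (kroot Lh) n.
set v := visser _ n in Vk Vh.
have -> : k h * uemb x - uemb x * k h =
    (uemb x * (1 - k h - v) - (1 - k h - v) * uemb x) + (uemb x * v - v * uemb x).
  rewrite commutator_sub1 -{1 2}[1 - k h](subrK v).
  by rewrite mulrDr mulrDl opprD addrACA.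
apply: ubound_le (uboundD (uboundB (uboundM (ubound_emb x) Vk) (uboundM Vk (ubound_emb x))) Vh).
move: ne; rewrite ltr_pdivlMr; last by lra.
have := visser_bound_cvg n; nra.
Qed.

(** Because k^2 = 1 - h^2, |k x|^2 <= |x| |x - h^2 x| <= 2 |x| |x - h x|, which tends to 0 for x in
    J. *)
Lemma root_net_ideal x : J x -> K * c x ~= 0.
Proof.
move=> Jx; split=> [h Lh|e e0] /=; first by rewrite subr0; apply: uidealMl.
have x0 := nrm_ge0 x.
have ee0 : 0 < e ^+ 2 / (2 * (nrm x + 1)) by rewrite divr_gt0 ?exprn_gt0// mulr_gt0//; lra.
have [hx _] : h ** x @[h --> tails Lam] --> x /\ x ** h @[h --> tails Lam] --> x.
  by case: Lqc => -[_ _ +] _; apply.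
apply: filterS (tails_cvg hx ee0) => h [Lh {}hx].
rewrite subr0 -uemb_actE; apply: ubound_le (ubound_emb _).
rewrite -(ler_pXn2r (n := 2)) ?nnegrE ?nrm_ge0 ?(ltW e0)// -nrm_cstar.
rewrite uact_adj (psqrt_star (kroot Lh)) -uactM (psqrt_sqr (kroot Lh)) uactBl uact1 uactM !uact_emb.
have := nrm_amul x^# (x - h ** (h ** x)).
have -> : x - h ** (h ** x) = (x - h ** x) + h ** (x - h ** x).
  by rewrite amulBr addrA subrK.
have := nrmD (x - h ** x) (h ** (x - h ** x)); have := nrm_amul h (x - h ** x).
move: hx; rewrite ltr_pdivlMr; last by lra.
rewrite nrm_star; have := L1 Lh; have := nrm_ge0 (x - h ** x).
set a := nrm (x - _); set b := nrm h; set d := nrm (h ** _).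
set f := nrm (_ + _); set g := nrm (_ ** _).
move=> a0 b1 ae db fd gf.
have dd : d <= a by nra.
nra.
Qed.

(** Behind a factor k only the coset of an element matters: congruences modulo J become equalities
    modulo null nets. *)
Lemma root_net_eqv x y : J (x - y) -> K * c x ~= K * c y.
Proof.
move=> /root_net_ideal h; have -> : c x = c (x - y) + c y by rewrite -bnet_constD subrK.
by rewrite mulrDr h add0r; reflexivity.
Qed.

(** * Congruence modulo J *)

Definition ideal_eqv x y := J (x - y).
Local Notation "x =J y" := (ideal_eqv x y) (at level 70).

#[local] Instance ideal_eqv_equivalence : RelationClasses.Equivalence ideal_eqv.
Proof.
case: Jideal => J0 JD _ _ _; split=> [x|x y|x y z]; rewrite /ideal_eqv.
- by rewrite subrr.
- by move/(idealN Jideal); rewrite opprB.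
- by move=> xy yz; rewrite -(subrKA y); exact: JD.
Qed.

#[local] Instance ideal_add_proper : Morphisms.Proper
  (Morphisms.respectful ideal_eqv (Morphisms.respectful ideal_eqv ideal_eqv)) +%R.
Proof.
by move=> x y xy z t zt; rewrite /ideal_eqv opprD addrACA; case: Jideal => _ JD _ _ _; exact: JD.
Qed.

#[local] Instance ideal_opp_proper : Morphisms.Proper
  (Morphisms.respectful ideal_eqv ideal_eqv) -%R.
Proof. by move=> x y xy; rewrite /ideal_eqv -opprD; exact: idealN. Qed.

#[local] Instance ideal_mul_proper : Morphisms.Proper
  (Morphisms.respectful ideal_eqv (Morphisms.respectful ideal_eqv ideal_eqv)) (@amul R[i] B).
Proof.
move=> x y xy z t zt; transitivity (x ** t); rewrite /ideal_eqv.
  by rewrite -amulBr; have [] := JM x zt.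
by rewrite -amulBl; have [] := JM t xy.
Qed.

#[local] Instance ideal_star_proper : Morphisms.Proper
  (Morphisms.respectful ideal_eqv ideal_eqv) (@astar R[i] B).
Proof. by move=> x y xy; rewrite /ideal_eqv -astarB; exact: ideal_star. Qed.

Lemma ideal_eqv0 x : J x <-> x =J 0.
Proof. by rewrite /ideal_eqv subr0. Qed.

Lemma partial_isometry_coset b :
  partial_isometry (cmul J) cstar (coset J b) -> b ** b^# ** b =J b.
Proof.
have [J0 _ _ _ _] := Jideal.
rewrite /partial_isometry => /seteqP[+ _] => /(_ (b ** b^# ** b)) [|j Jj <-].
  have bb : coset J b b by exists 0; rewrite ?addr0.
  exists (b ** b^#), b, 0; split; rewrite ?addr0//.
  by exists b, b^#, 0; split; rewrite ?addr0//; exists b.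
by rewrite /ideal_eqv addrAC subrr add0r.
Qed.

(** * The partial isometry u = h a + k b r *)

Section Partial.
Variables a b r : B.
Local Notation p := (a^# ** a).
Local Notation q := (b^# ** b).
Local Notation d := (b ** r).
Hypothesis ha : a ** a^# ** a = a.
Hypothesis hb : b ** b^# ** b =J b.
Hypothesis rp : r^# ** r =J p.
Hypothesis rq : r ** r^# =J q.
Hypothesis ab : a^# ** b =J 0.

Lemma initial_proj : p ** p = p.
Proof. by rewrite -amulA (amulA a) ha. Qed.

Lemma initial_proj_star : p^# = p.
Proof. by rewrite astarM astarK. Qed.

(* x = r - r p satisfies x^* x = 0 modulo J. *)
Lemma right_support : r ** p =J r.
Proof.
symmetry; rewrite /ideal_eqv; apply/ideal_cstar/(ideal_eqv0 _).2.
rewrite astarB astarM initial_proj_star amulBl !amulBr.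
rewrite -!(amulA p) !(amulA r^#) rp !initial_proj !subrr.
reflexivity.
Qed.

(** Modulo J, q r = r r^# r = r p = r. *)
Lemma left_support : q ** r =J r.
Proof. by rewrite -rq -amulA rp right_support; reflexivity. Qed.

(** Modulo J, r carries p to the initial projection q of b, so d = b r has the same initial
    projection as a. *)
Lemma final_part_initial : d^# ** d =J p.
Proof. by rewrite astarM -amulA (amulA b^#) left_support rp; reflexivity. Qed.

Lemma final_part_final : d ** d^# =J b ** b^#.
Proof. by rewrite astarM -amulA (amulA r) rq amulA amulA hb; reflexivity. Qed.

Lemma orthogonal_parts : a^# ** d =J 0.
Proof. by rewrite amulA ab amul0l; reflexivity. Qed.

(** Modulo J, a and d have equal initial and orthogonal final projections, and the squares of the
    weights h and k sum to 1. *)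
Definition transport := H * c a + K * c d.
Local Notation u := transport.

Lemma transport_star : bnet_star u ~= H * c a^# + K * c d^#.
Proof.
rewrite /u bnet_starD !bnet_starM !bnet_star_const unit_net_star root_net_star.
by rewrite unit_net_central root_net_central; reflexivity.
Qed.

Lemma unit_shift x F : c x * (H * F) ~= H * (c x * F).
Proof. by rewrite !mulrA unit_net_central; reflexivity. Qed.

Lemma root_shift x F : c x * (K * F) ~= K * (c x * F).
Proof. by rewrite !mulrA root_net_central; reflexivity. Qed.

Lemma root_unit_shift F : K * (H * F) ~= H * (K * F).
Proof. by rewrite !mulrA unit_root_comm; reflexivity. Qed.

Lemma root_net_ideal_eqv x y : x =J y -> K * c x ~= K * c y.
Proof. exact: root_net_eqv. Qed.

Lemma root_net_ideal0 x : x =J 0 -> K * c x ~= 0.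
Proof. by move=> x0; apply/root_net_ideal/(ideal_eqv0 x).2. Qed.

Lemma unit_root_sqrE F : H * (H * F) + K * (K * F) ~= F.
Proof. by rewrite !mulrA -mulrDl unit_root_sqr mul1r; reflexivity. Qed.

(** The cross terms carry a factor k and a^# d or d^# a in J, hence vanish; what remains is h^2 p +
    k^2 p = p. *)
Lemma transport_initial : bnet_star u * u ~= c p.
Proof.
rewrite transport_star /u mulrDl !mulrDr -!mulrA !unit_shift !root_shift -!bnet_constM.
rewrite (root_net_ideal0 orthogonal_parts) mulr0 addr0.
have da : d^# ** a =J 0.
  by rewrite -[d^# ** a]astarK astarM astarK orthogonal_parts astar0; reflexivity.
rewrite root_unit_shift (root_net_ideal0 da) mulr0 add0r.
by rewrite (root_net_ideal_eqv final_part_initial) unit_root_sqrE; reflexivity.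
Qed.

Lemma transport_support : u * c p ~= u.
Proof.
rewrite /u mulrDl -!mulrA -!bnet_constM amulA ha.
suff dp : d ** p =J d by rewrite (root_net_ideal_eqv dp); reflexivity.
by rewrite -amulA right_support; reflexivity.
Qed.

Lemma transport_support_star : c p * bnet_star u ~= bnet_star u.
Proof.
rewrite -{2}transport_support bnet_starM bnet_star_const initial_proj_star.
reflexivity.
Qed.

Lemma transport_final : u * bnet_star u ~=
  H * H * c (a ** a^#) + K * K * c (b ** b^#) + H * (K * c (b ** r ** a^# + a ** r^# ** b^#)).
Proof.
rewrite transport_star /u mulrDl !mulrDr -!mulrA !unit_shift !root_shift -!bnet_constM.
rewrite (root_net_ideal_eqv final_part_final) root_unit_shift bnet_constD !mulrDr.
rewrite astarM amulA.
rewrite -!addrA; apply: bnet_eqvD => //; first reflexivity.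
rewrite addrCA addrA addrC addrA addrC addrA.
reflexivity.
Qed.

Lemma transport_partial_isometry : u * bnet_star u * u ~= u.
Proof. by rewrite -mulrA transport_initial transport_support; reflexivity. Qed.

(** Here b r = b p, which is b q and so b modulo J. *)
Lemma transport_case1 : p =J q -> r = p -> H * c a + K * c b ~= u.
Proof.
move=> pq rE; suff db : d =J b by rewrite /u (root_net_ideal_eqv db); reflexivity.
by rewrite rE pq amulA hb; reflexivity.
Qed.

(** * Case (ii): the factorization w = u t *)

Section Case2.
Hypothesis ab' : a ** b^# =J 0.

Definition turn := H + c r^# * K.
Local Notation t := turn.

Lemma turn_star : bnet_star t ~= H + K * c r.
Proof.
rewrite /t bnet_starD bnet_starM bnet_star_const astarK unit_net_star root_net_star.
reflexivity.
Qed.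

Lemma right_support_star : p ** r^# =J r^#.
Proof. by rewrite -{1}initial_proj_star -astarM right_support; reflexivity. Qed.

(** Modulo J, p r = p q r = a^# (a b^#) b r; this is where a b^# in J enters. *)
Lemma left_support_orthogonal : p ** r =J 0.
Proof.
by rewrite -left_support amulA -(amulA a^#) (amulA a) ab' amul0l amul0r amul0l; reflexivity.
Qed.

Lemma left_support_orthogonal_star : r^# ** p =J 0.
Proof. by rewrite -{1}initial_proj_star -astarM left_support_orthogonal astar0; reflexivity. Qed.

(** Expanding (h a + k b r) (h + r^# k) gives the formula for w, since b r r^# is b modulo J. *)
Lemma transport_case2 :
  H * H * c a + K * K * c b + H * (K * c (a ** r^# + b ** r)) ~= u * t.
Proof.
have db : d ** r^# =J b by rewrite -amulA rq amulA hb; reflexivity.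
rewrite /u /t mulrDl !mulrDr -!mulrA !unit_net_central.
rewrite (mulrA (c a)) (mulrA (c d)) -!bnet_constM !root_net_central.
rewrite (root_net_ideal_eqv db) root_unit_shift bnet_constD !mulrDr.
rewrite addrACA (addrC (K * (K * c b))).
reflexivity.
Qed.

Lemma turn_initial : bnet_star t * (c p * t) ~=
  H * H * c p + K * K * c q + H * (K * c (r + r^#)).
Proof.
have rpr : r ** (p ** r^#) =J q by rewrite right_support_star rq; reflexivity.
rewrite turn_star /t mulrDl !mulrDr -!mulrA.
rewrite !(mulrA (c p) (c _)) -!bnet_constM !unit_net_central.
rewrite !root_net_central unit_shift root_shift -!bnet_constM.
rewrite (root_net_ideal_eqv right_support_star) root_unit_shift.
rewrite (root_net_ideal_eqv right_support) (root_net_ideal_eqv rpr) bnet_constD !mulrDr.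
rewrite addrACA (addrC (H * (K * c r^#))) addrACA.
reflexivity.
Qed.

(** Since p t is h p + k r^#, the product is h^2 p + k^2 r^# r plus cross terms in k p r and k r^#
    p, which vanish because p r lies in J. *)
Lemma turn_final : c p * (t * (bnet_star t * c p)) ~= c p.
Proof.
have rr : r^# ** r =J p by [].
have pt : c p * t ~= H * c p + K * c r^#.
  rewrite /t mulrDr unit_net_central mulrA -bnet_constM root_net_central.
  by rewrite (root_net_ideal_eqv right_support_star); reflexivity.
have tp : bnet_star t * c p ~= H * c p + K * c r.
  rewrite turn_star mulrDl -mulrA -bnet_constM (root_net_ideal_eqv right_support).
  reflexivity.
rewrite mulrA pt tp mulrDl !mulrDr -!mulrA.
rewrite !unit_shift !root_shift -!bnet_constM initial_proj.
rewrite (root_net_ideal0 left_support_orthogonal) mulr0 addr0 root_unit_shift.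
rewrite (root_net_ideal0 left_support_orthogonal_star) mulr0 add0r (root_net_ideal_eqv rr).
by rewrite unit_root_sqrE; reflexivity.
Qed.

Lemma turned_initial : bnet_star (u * t) * (u * t) ~=
  H * H * c p + K * K * c q + H * (K * c (r + r^#)).
Proof.
rewrite bnet_starM -mulrA (mulrA (bnet_star u)) transport_initial.
exact: turn_initial.
Qed.

(** Inserting u = u p gives u (p t t^# p) u^# = u u^#, so w w^# is the same as for u. *)
Lemma turned_final : (u * t) * bnet_star (u * t) ~= u * bnet_star u.
Proof.
rewrite bnet_starM -{1}transport_support -transport_support_star.
rewrite -!mulrA (mulrA (bnet_star t)) (mulrA t) (mulrA (c p)) turn_final transport_support_star.
reflexivity.
Qed.

Lemma turned_partial_isometry : u * t * bnet_star (u * t) * (u * t) ~= u * t.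
Proof. by rewrite turned_final mulrA transport_partial_isometry; reflexivity. Qed.

End Case2.

End Partial.

Lemma root_combination_net x y z h : (H * H * c x + K * K * c y + H * (K * c z)) h =
  uemb (h ** h ** x + uact (k h ** k h) y + h ** uact (k h) z).
Proof.
by rewrite uembD (uembD (h ** h ** x)) uemb_actE !(uembM h) !(uembM (h ** h)) (uembM h) uemb_actE.
Qed.

(** The net W given by the formula for w may be replaced by the factored net V, for which the three
    relations have been computed. *)
Lemma approx_mod_nets (W V E F : bnet Lam) (w e f : B -> B) :
  (forall h, W h = uemb (w h)) -> (forall h, E h = uemb (e h)) ->
  (forall h, F h = uemb (f h)) ->
  W ~= V -> V * bnet_star V * V ~= V -> bnet_star V * V ~= E -> V * bnet_star V ~= F ->
  [/\ approx_mod J Lam (fun h => w h ** (w h)^# ** w h) w,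
      approx_mod J Lam (fun h => (w h)^# ** w h) e &
      approx_mod J Lam (fun h => w h ** (w h)^#) f].
Proof.
move=> Ww Ee Ff WV V1 V2 V3; split.
- apply: (@approx_mod_bnet _ _ _ _ Ldir _ _ (W * bnet_star W * W) W) => // [h _|].
    by rewrite !uembM uemb_star -Ww.
  by rewrite WV.
- apply: (@approx_mod_bnet _ _ _ _ Ldir _ _ (bnet_star W * W) E) => // [h _|].
    by rewrite !uembM uemb_star -Ww.
  by rewrite WV.
- apply: (@approx_mod_bnet _ _ _ _ Ldir _ _ (W * bnet_star W) F) => // [h _|].
    by rewrite !uembM uemb_star -Ww.
  by rewrite WV.
Qed.

End QuasiCentral.

Theorem lemma3p6 (R : realType) (B : cstarAlgType R) (J : set B) (a b r : B)
    (Lam : set B) (k : B -> unitization B) :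
  closed_ideal J ->
  partial_isometry amul astar a ->
  partial_isometry (cmul J) cstar (coset J b) ->
  J (r^# ** r - a^# ** a) ->
  J (r ** r^# - b^# ** b) ->
  quasi_central_approximate_unit J Lam ->
  (forall h, Lam h -> is_psqrt (uone - uemb (h ** h)) (k h)) ->
  (J (a^# ** b) -> J (a^# ** a - b^# ** b) -> r = a^# ** a ->
   let w h := h ** a + uact (k h) b in
   [/\ approx_mod J Lam (fun h => w h ** (w h)^# ** w h) w,
       approx_mod J Lam (fun h => (w h)^# ** w h) (fun=> a^# ** a) &
       approx_mod J Lam (fun h => w h ** (w h)^#)
         (fun h => h ** h ** (a ** a^#) + uact (k h ** k h) (b ** b^#)
                   + h ** uact (k h) (b ** r ** a^# + a ** r^# ** b^#))]) /\
  (J (a^# ** b) -> J (a ** b^#) ->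
   mvn_equiv (cosets J) (cmul J) cstar (coset J (a^# ** a)) (coset J (b^# ** b)) ->
   let w h := h ** h ** a + uact (k h ** k h) b
              + h ** uact (k h) (a ** r^# + b ** r) in
   [/\ approx_mod J Lam (fun h => w h ** (w h)^# ** w h) w,
       approx_mod J Lam (fun h => (w h)^# ** w h)
         (fun h => h ** h ** (a^# ** a) + uact (k h ** k h) (b^# ** b)
                   + h ** uact (k h) (r + r^#)) &
       approx_mod J Lam (fun h => w h ** (w h)^#)
         (fun h => h ** h ** (a ** a^#) + uact (k h ** k h) (b ** b^#)
                   + h ** uact (k h) (b ** r ** a^# + a ** r^# ** b^#))]).
Proof.
move=> Jideal ha /(partial_isometry_coset Jideal) hb rp rq Lqc kroot.
have Ldir : upward_directed Lam by case: Lqc => -[].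
split=> [ab pq rE w|ab ab' _ w]; have ab0 := (ideal_eqv0 J _).1 ab.
- apply: (approx_mod_nets Jideal Lqc _ _ (root_combination_net Lqc kroot _ _ _)
    (transport_case1 Jideal Lqc kroot hb pq rE)
    (transport_partial_isometry Jideal Lqc kroot ha rp rq ab0)
    (transport_initial Jideal Lqc kroot ha rp rq ab0)
    (transport_final Jideal Lqc kroot a hb rq)) => h //.
  by rewrite uembD uembM uemb_actE.
- apply: (approx_mod_nets Jideal Lqc (root_combination_net Lqc kroot _ _ _)
    (root_combination_net Lqc kroot _ _ _) (root_combination_net Lqc kroot _ _ _)
    (transport_case2 Jideal Lqc kroot a hb rq)
    (turned_partial_isometry Jideal Lqc kroot ha rp rq ab0 ((ideal_eqv0 J _).1 ab'))
    (turned_initial Jideal Lqc kroot ha rp rq ab0) _).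
  apply: bnet_eqv_trans (turned_final Jideal Lqc kroot ha rp rq ((ideal_eqv0 J _).1 ab'))
    (transport_final Jideal Lqc kroot a hb rq) => //.
Qed.
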